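(* Consider the following statements about (commutative) semirings, where ''finitely generated'' means finitely generated as a semiring: (A) Every finitely generated additively divisible semiring is additively idempotent. (A1) Every finitely generated additively uniquely divisible semiring is additively idempotent. (B) No finitely generated semiring contains a copy of $\mathbb{Q}^{+}$ (i.e. a subsemiring isomorphic to $\mathbb{Q}^{+}$). (B1) No finitely generated semiring with a unit element contains a copy of $\mathbb{Q}^{+}$ sharing the unit (i.e. a subsemiring $Q\cong\mathbb{Q}^{+}$ whose unit element is the unit element of the semiring). (B2) Every finitely generated additively divisible semiring with a unit is additively idempotent. (C) Every parasemifield that is finitely generated as a semiring is additively idempotent. (C1) Every finitely generated infinite and ideal-simple semiring is additively idempotent or isomorphic to the semiring $U(G)$ for an infinite finitely generated abelian group $G$. Then $(\mathrm{A})\Leftrightarrow(\mathrm{A1})\Rightarrow(\mathrm{B})\Leftrightarrow(\mathrm{B1})\Leftrightarrow(\mathrm{B2})\Rightarrow(\mathrm{C})\Leftrightarrow(\mathrm{C1})$.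
   Context: A semiring is a non-empty set with two commutative and associative binary operations, addition and multiplication, such that multiplication distributes over addition; no additively or multiplicatively neutral element is assumed. A unit of a semiring is a multiplicatively neutral element. A parasemifield is a semiring whose multiplicative semigroup is a non-trivial group. $\mathbb{Q}^{+}$ is the parasemifield of positive rationals with the usual operations. $\mathbb{N}$ denotes the positive integers; $na$ is the sum of $n$ copies of $a$. A semiring $S$ is additively divisible (additively uniquely divisible) if for every $a\in S$ and $n\in\mathbb{N}$ there is some $b\in S$ (exactly one $b\in S$) with $a=nb$. $S$ is additively idempotent if $a+a=a$ for all $a\in S$. An ideal of $S$ is a non-empty subset $I$ with $I+I\subseteq I$ and $SI\subseteq I$; $S$ is ideal-simple if it has at least two elements and the only ideal of $S$ with at least two elements is $S$ itself. For a multiplicatively written abelian group $G$ and an element $o\notin G$, $U(G)$ is the semiring on the set $G\cup\{o\}$ whose multiplication extends that of $G$ and with $x+y=xo=ox=o$ for all $x,y\in G\cup\{o\}$. *)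

(* Defs.v *)
From HB Require Import structures.
From mathcomp Require Import all_boot all_order all_algebra all_classical.

Set Implicit Arguments.
Unset Strict Implicit.
Unset Printing Implicit Defensive.

Import Order.TTheory GRing.Theory Num.Theory.

Local Open Scope classical_set_scope.
Local Open Scope ring_scope.

(* A commutative semiring with no neutral element assumed: the sum [x + y] is
   that of [addSemigroupType] (commutative and associative) and the product
   [(x * y)%g] that of [semigroupType] (associative).  The product is not
   [GRing.mul], whose structures all come with [0] and [1].
   The choice structure on the carrier is no restriction, since every type
   has one ([boolp.gen_choiceMixin]). *)
HB.mixin Record isCommutativeSemiring S
  of Algebra.AddSemigroup S & Semigroup S := {
  csemiring_inhabited : inhabited S;
  csmulC : commutative (@monoid.mul S);
  csmulDl : left_distributive (@monoid.mul S) (@Algebra.add S)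
}.

#[short(type="csemiringType")]
HB.structure Definition CSemiring :=
  {S of isCommutativeSemiring S & Algebra.AddSemigroup S & Semigroup S}.

Section Notions.
Variable S : csemiringType.
Implicit Types (A I : set S) (a b e x y : S).

Definition subsemiring A : Prop :=
  [/\ A !=set0,
      forall x y, A x -> A y -> A (x + y)
    & forall x y, A x -> A y -> A (x * y)%g].

Definition finitely_generated : Prop :=
  exists X : set S, finite_set X /\ smallest subsemiring X = [set: S].

(* the sum of n copies of a; meaningful for 0 < n only (there is no zero) *)
Definition nsum (n : nat) a : S := iterop n +%R a a.

Definition additively_divisible : Prop :=
  forall a (n : nat), (0 < n)%N -> exists b, a = nsum n b.

Definition additively_uniquely_divisible : Prop :=
  forall a (n : nat), (0 < n)%N -> exists! b, a = nsum n b.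

Definition additively_idempotent : Prop := forall a, a + a = a.

Definition unit_of A e : Prop := A e /\ forall x, A x -> (e * x)%g = x.

Definition is_unit e : Prop := unit_of [set: S] e.

Definition parasemifield : Prop :=
  exists e, [/\ is_unit e,
                forall x, exists y, (x * y)%g = e
              & exists x, x <> e].

Definition ideal I : Prop :=
  [/\ I !=set0,
      forall x y, I x -> I y -> I (x + y)
    & forall x y, I y -> I (x * y)%g].

Definition at_least_two A : Prop := exists x y, [/\ A x, A y & x <> y].

Definition ideal_simple : Prop :=
  at_least_two [set: S] /\
  forall I, ideal I -> at_least_two I -> I = [set: S].

End Notions.

Arguments finitely_generated S : clear implicits.
Arguments additively_divisible S : clear implicits.
Arguments additively_uniquely_divisible S : clear implicits.
Arguments additively_idempotent S : clear implicits.
Arguments parasemifield S : clear implicits.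
Arguments ideal_simple S : clear implicits.

Definition semiring_morphism (S T : csemiringType) (f : S -> T) : Prop :=
  {morph f : x y / x + y} /\ {morph f : x y / (x * y)%g}.

Definition isomorphic (S T : csemiringType) : Prop :=
  exists f : S -> T, semiring_morphism f /\ bijective f.

Definition posrat : Type := {x : rat | 0 < x}.

HB.instance Definition _ := Choice.on posrat.

Definition posrat_add (x y : posrat) : posrat :=
  exist _ (val x + val y) (addr_gt0 (valP x) (valP y)).

Definition posrat_mul (x y : posrat) : posrat :=
  exist _ (val x * val y) (mulr_gt0 (valP x) (valP y)).

Fact posrat_addC : commutative posrat_add.
Proof. by move=> x y; apply: val_inj; rewrite /= addrC. Qed.

Fact posrat_addA : associative posrat_add.
Proof. by move=> x y z; apply: val_inj; rewrite /= addrA. Qed.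

Fact posrat_mulC : commutative posrat_mul.
Proof. by move=> x y; apply: val_inj; rewrite /= mulrC. Qed.

Fact posrat_mulA : associative posrat_mul.
Proof. by move=> x y z; apply: val_inj; rewrite /= mulrA. Qed.

Fact posrat_mulDl : left_distributive posrat_mul posrat_add.
Proof. by move=> x y z; apply: val_inj; rewrite /= mulrDl. Qed.

Fact posrat_inhabited : inhabited posrat.
Proof. exact: (inhabits (exist _ 1 ltr01)). Qed.

HB.instance Definition _ := Algebra.isAddSemigroup.Build posrat posrat_addC posrat_addA.
HB.instance Definition _ := isSemigroup.Build posrat posrat_mulA.
HB.instance Definition _ :=
  isCommutativeSemiring.Build posrat posrat_inhabited posrat_mulC posrat_mulDl.

Definition posrat_copy (S : csemiringType) (Q : set S) : Prop :=
  subsemiring Q /\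
  exists f : posrat -> S, semiring_morphism f /\ set_bij [set: posrat] Q f.

(* The semiring U(G).  Abelian groups are the library's [zmodType]s, so the
   group law of [G] is written [+] even though it becomes the product of
   [Ugroup G]; [None] is the extra element o. *)
Definition Ugroup (G : zmodType) : Type := option G.

Section UgroupSemiring.
Variable G : zmodType.

HB.instance Definition _ := Choice.on (Ugroup G).

Definition Ugroup_add (x y : Ugroup G) : Ugroup G := None.

Definition Ugroup_mul (x y : Ugroup G) : Ugroup G :=
  if x is Some g then if y is Some h then Some (g + h) else None else None.

Fact Ugroup_addC : commutative Ugroup_add.
Proof. by []. Qed.

Fact Ugroup_addA : associative Ugroup_add.
Proof. by []. Qed.

Fact Ugroup_mulC : commutative Ugroup_mul.
Proof. by move=> [x|] [y|] //=; rewrite addrC. Qed.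

Fact Ugroup_mulA : associative Ugroup_mul.
Proof. by move=> [x|] [y|] [z|] //=; rewrite addrA. Qed.

Fact Ugroup_mulDl : left_distributive Ugroup_mul Ugroup_add.
Proof. by []. Qed.

Fact Ugroup_inhabited : inhabited (Ugroup G).
Proof. exact: (inhabits None). Qed.

HB.instance Definition _ :=
  Algebra.isAddSemigroup.Build (Ugroup G) Ugroup_addC Ugroup_addA.
HB.instance Definition _ := isSemigroup.Build (Ugroup G) Ugroup_mulA.
HB.instance Definition _ :=
  isCommutativeSemiring.Build (Ugroup G)
    Ugroup_inhabited Ugroup_mulC Ugroup_mulDl.

Definition subgroup (H : set G) : Prop :=
  H 0 /\ forall x y, H x -> H y -> H (x - y).

Definition finitely_generated_group : Prop :=
  exists X : set G, finite_set X /\ smallest subgroup X = [set: G].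

End UgroupSemiring.

Arguments finitely_generated_group G : clear implicits.

Definition statement_A : Prop :=
  forall S : csemiringType,
    finitely_generated S -> additively_divisible S -> additively_idempotent S.

Definition statement_A1 : Prop :=
  forall S : csemiringType,
    finitely_generated S -> additively_uniquely_divisible S ->
    additively_idempotent S.

Definition statement_B : Prop :=
  forall S : csemiringType,
    finitely_generated S -> ~ exists Q : set S, posrat_copy Q.

Definition statement_B1 : Prop :=
  forall (S : csemiringType) (e : S),
    finitely_generated S -> is_unit e ->
    ~ exists Q : set S, posrat_copy Q /\ unit_of Q e.

Definition statement_B2 : Prop :=
  forall S : csemiringType,
    finitely_generated S -> (exists e : S, is_unit e) ->
    additively_divisible S -> additively_idempotent S.

Definition statement_C : Prop :=
  forall S : csemiringType,
    parasemifield S -> finitely_generated S -> additively_idempotent S.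

Definition statement_C1 : Prop :=
  forall S : csemiringType,
    finitely_generated S -> infinite_set [set: S] -> ideal_simple S ->
    additively_idempotent S \/
    exists G : zmodType,
      [/\ infinite_set [set: G], finitely_generated_group G
        & isomorphic S (Ugroup G)].

(* Main.v *)
(* Identifying a and b when n a = n b for some n > 0 turns an additively
   divisible semiring into a uniquely divisible one, and a finitely generated
   divisible semiring with n a = 2 n a for all a (n depending on a) is
   idempotent because n can be chosen uniformly; this gives (A1) => (A).  If
   there is a unit 1, either two multiples of 1 coincide, which again forces
   idempotence, or the quotient contains Q^+ with the same unit: (B1) => (B2).
   Conversely a copy of Q^+ sharing the unit makes the semiring divisible, and
   a copy of Q^+ with unit e shares it with the image of x |-> e x.

   For (C) => (C1), an ideal-simple semiring is a parasemifield, or has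
   constant multiplication (and is then finite), or is a group G together with
   a multiplicatively absorbing w.  In the last case w is either an additive
   zero or additively absorbing.  If w is zero and -1 exists, S is a field
   finitely generated as a ring, hence finite: by Kaplansky's descent for
   Goldman domains, if R[u] is Goldman then so is R, and u is algebraic over R.
   If w absorbs addition and 1 + 1 = w, then addition is constant and
   S = U(G).  Otherwise the quotients of elements below 1 form a parasemifield
   D in which a + b in D implies a in D; by Dickson's lemma D is finitely
   generated, so (C) gives 1 + 1 = 1. *)
From HB Require Import structures.
From mathcomp Require Import all_boot all_order all_algebra all_classical.
From mathcomp Require Import generic_quotient zify ring.
Require Import Defs.

Set Implicit Arguments.
Unset Strict Implicit.
Unset Printing Implicit Defensive.

Import Order.TTheory GRing.Theory Num.Theory.

Local Open Scope classical_set_scope.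
Local Open Scope ring_scope.
Local Open Scope quotient_scope.

(* [GRing.Theory] states these laws only for additive monoids with a zero. *)
Local Notation csaddC := Algebra.addrC.
Local Notation csaddA := Algebra.addrA.
Local Notation csaddCA := Algebra.addrCA.
Local Notation csaddACA := Algebra.addrACA.

(** * Multiples, finite generation and torsion *)

Section SemiringTheory.
Variable S : csemiringType.
Implicit Types (a b e x y z t : S) (m n : nat).

Lemma csmulDr x y z : (x * (y + z))%g = (x * y)%g + (x * z)%g.
Proof. by rewrite csmulC csmulDl ![(x * _)%g]csmulC. Qed.

Lemma csmulCA x y z : (x * (y * z))%g = (y * (x * z))%g.
Proof. by rewrite !mulgA (csmulC x). Qed.

Lemma csmulACA x y z t : ((x * y) * (z * t))%g = ((x * z) * (y * t))%g.
Proof. by rewrite -!mulgA (csmulCA y). Qed.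

Lemma nsum1 a : nsum 1 a = a. Proof. by []. Qed.

Lemma nsumS n a : nsum n.+2 a = a + nsum n.+1 a.
Proof. by rewrite /nsum !iteropS. Qed.

Lemma nsum2 a : nsum 2 a = a + a.
Proof. by []. Qed.

Lemma nsum_add n a b : nsum n (a + b) = nsum n a + nsum n b.
Proof.
case: n => [//|]; elim=> [//|n IH].
by rewrite !nsumS IH csaddACA.
Qed.

Lemma nsum_mull n a b : nsum n (a * b)%g = (nsum n a * b)%g.
Proof.
case: n => [//|]; elim=> [//|n IH].
by rewrite !nsumS IH csmulDl.
Qed.

Lemma nsum_mulr n a b : nsum n (a * b)%g = (a * nsum n b)%g.
Proof. by rewrite csmulC nsum_mull csmulC. Qed.

Lemma nsumD m n a :
  (0 < m)%N -> (0 < n)%N -> nsum (m + n) a = nsum m a + nsum n a.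
Proof.
case: m => // m _; case: n => // n _.
elim: m => [|m IH]; first by rewrite add1n nsumS.
by rewrite addSn addSn nsumS -addSn IH nsumS csaddA.
Qed.

Lemma nsumM m n a :
  (0 < m)%N -> (0 < n)%N -> nsum (m * n) a = nsum m (nsum n a).
Proof.
case: m => // m _ n0; elim: m => [|m IH]; first by rewrite mul1n.
by rewrite mulSn nsumD ?muln_gt0 ?n0 // IH nsumS.
Qed.

Lemma nsumC m n a :
  (0 < m)%N -> (0 < n)%N -> nsum m (nsum n a) = nsum n (nsum m a).
Proof. by move=> m0 n0; rewrite -!nsumM // mulnC. Qed.

Lemma nsum_mul m n a b : (0 < m)%N -> (0 < n)%N ->
  (nsum m a * nsum n b)%g = nsum (m * n) (a * b)%g.
Proof. by move=> m0 n0; rewrite nsumM // nsum_mulr nsum_mull. Qed.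

(** Recasts finite generation as an induction principle. *)
Lemma finitely_generatedP : finitely_generated S <->
  exists s : seq S, forall P : S -> Prop,
    (forall x, x \in s -> P x) ->
    (forall x y, P x -> P y -> P (x + y)) ->
    (forall x y, P x -> P y -> P (x * y)%g) ->
    forall x, P x.
Proof.
split=> [[X [/finite_seqP[s ->] sX]]|[s Hs]].
- have [x0] := @csemiring_inhabited S.
  (* [X] may be empty but a subsemiring may not; the extra generator [x0] makes [P] inhabited. *)
  exists (x0 :: s) => P Ps PD PM x.
  have : smallest (@subsemiring S) [set` s] x by rewrite sX.
  apply; split=> [|y ys]; last by apply: Ps; rewrite inE ys orbT.
  by split=> //; exists x0; apply: Ps; rewrite mem_head.
- exists [set` s]; split; first exact: finite_seq.
  apply/seteqP; split=> // x _ A [[A0 AD AM] sA].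
  by apply: Hs => // y ys; apply: sA.
Qed.

(** Writing a as n b turns n b = n (b + b) into a = a + a. *)
Lemma torsion_idempotent n : (0 < n)%N ->
  (forall a, nsum n a = nsum n (a + a)) ->
  additively_divisible S -> additively_idempotent S.
Proof.
move=> n0 Hn Sdiv a; have [b ->] := Sdiv a n n0.
by rewrite -nsum_add -Hn.
Qed.

(** The product of the integers found for the generators serves all of them, and for a fixed n the
    law n x = n (x + x) passes to sums and products. *)
Lemma fg_torsion_idempotent : finitely_generated S ->
  (forall a, exists2 n, (0 < n)%N & nsum n a = nsum n (a + a)) ->
  additively_divisible S -> additively_idempotent S.
Proof.
move=> /finitely_generatedP[s Hs] tor.
have [n n0 Hn] : exists2 n, (0 < n)%N &
    forall x, x \in s -> nsum n x = nsum n (x + x).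
  elim: s {Hs} => [|x s [n n0 IH]]; first by exists 1%N.
  have [m m0 Hm] := tor x; exists (m * n)%N; first by rewrite muln_gt0 m0.
  move=> y; rewrite inE => /predU1P[->|ys].
  - by rewrite mulnC !nsumM // Hm.
  - by rewrite !nsumM // IH.
apply: (torsion_idempotent n0); apply: Hs => // x y Hx Hy.
- by rewrite csaddACA 2!nsum_add Hx Hy.
- by rewrite -csmulDl !nsum_mull Hx.
Qed.

Lemma nsum_unit e n a : is_unit e -> nsum n a = (nsum n e * a)%g.
Proof. by move=> [_ ue]; rewrite -nsum_mull ue. Qed.

(** The multiples of [e] are periodic from [m] on, with period d = k - m. Since m d is at least m
    and a multiple of d, m d and 2 m d give the same multiple of [e], hence of every a. *)
Lemma unit_multiples_torsion e m k : is_unit e -> (0 < m)%N -> (m < k)%N ->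
  nsum m e = nsum k e ->
  exists2 n, (0 < n)%N & forall a, nsum n a = nsum n (a + a).
Proof.
move=> ue m0 mk; have d0 : (0 < k - m)%N by rewrite subn_gt0.
rewrite -(subnKC (ltnW mk)); set d := (k - m)%N in d0 * => {mk} He.
have Hj j : nsum m e = nsum (m + j * d) e.
  elim: j => [|j IH]; first by rewrite mul0n addn0.
  rewrite mulSn (addnC d) addnA; case: j => [|j] in IH *.
    by rewrite mul0n addn0.
  by rewrite nsumD ?addn_gt0 ?m0 // -IH -nsumD.
(* [nsum 0 e] is [e], not a zero, so [nsumD] can split off only a positive i. *)
have Hi i : nsum (m + i) e = nsum (m + i + m * d) e.
  case: i => [|i]; first by rewrite addn0; apply: Hj.
  by rewrite addnAC [LHS]nsumD // [RHS]nsumD ?addn_gt0 ?m0 // -Hj.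
exists (m * d)%N; first by rewrite muln_gt0 m0.
move=> a; rewrite nsum_add -nsumD ?muln_gt0 ?m0 // !(nsum_unit _ a ue).
have le : (m <= m * d)%N by rewrite leq_pmulr.
by rewrite -{1}(subnKC le) Hi subnKC.
Qed.

End SemiringTheory.

Lemma fg_surj (S T : csemiringType) (f : S -> T) :
  semiring_morphism f -> (forall y, exists x, f x = y) ->
  finitely_generated S -> finitely_generated T.
Proof.
move=> [fD fM] fs /finitely_generatedP[s Hs]; apply/finitely_generatedP.
exists (map f s) => P Ps PD PM y; have [x <-] := fs y; move: x.
apply: Hs => [x xs|x y'|x y']; first by apply: Ps; apply: map_f.
- by rewrite fD; apply: PD.
- by rewrite fM; apply: PM.
Qed.

Lemma morph_nsum (S T : csemiringType) (f : S -> T) n a :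
  semiring_morphism f -> f (nsum n a) = nsum n (f a).
Proof.
move=> [fD _]; case: n => [//|]; elim=> [//|n IH].
by rewrite !nsumS fD IH.
Qed.

(** * Quotients by congruences *)

Record congruence (S : csemiringType) (r : rel S) : Prop := Congruence {
  congruence_refl : reflexive r;
  congruence_sym : symmetric r;
  congruence_trans : transitive r;
  congruenceD : forall z x y, r x y -> r (x + z) (y + z);
  congruenceM : forall z x y, r x y -> r (x * z)%g (y * z)%g }.

Definition congruence_equiv (S : csemiringType) (r : rel S)
    (H : congruence r) : equiv_rel S :=
  EquivRel r (congruence_refl H) (congruence_sym H) (congruence_trans H).

Definition quotient_semiring (S : csemiringType) (r : rel S)
  (H : congruence r) : Type := {eq_quot congruence_equiv H}.

Section Quotient.
Variables (S : csemiringType) (r : rel S) (H : congruence r).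
Local Notation Q := (quotient_semiring H).

HB.instance Definition _ := Choice.on Q.

Definition proj (x : S) : Q := \pi_{eq_quot congruence_equiv H} x.

Definition rep (u : Q) : S := repr (u : {eq_quot congruence_equiv H}).

Lemma repK u : proj (rep u) = u. Proof. exact: reprK. Qed.

Lemma proj_eq x y : proj x = proj y <-> r x y.
Proof. by split=> [/eqmodP|?]; last apply/eqmodP. Qed.

Lemma rep_proj x : r (rep (proj x)) x.
Proof. by apply/proj_eq; rewrite repK. Qed.

Definition quo_add (u v : Q) : Q := proj (rep u + rep v).
Definition quo_mul (u v : Q) : Q := proj (rep u * rep v)%g.

Lemma quo_addE x y : quo_add (proj x) (proj y) = proj (x + y).
Proof.
apply/proj_eq; apply: (congruence_trans H) (congruenceD H _ (rep_proj x)) _.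
by rewrite ![x + _]csaddC; exact: (congruenceD H _ (rep_proj y)).
Qed.

Lemma quo_mulE x y : quo_mul (proj x) (proj y) = proj (x * y)%g.
Proof.
apply/proj_eq; apply: (congruence_trans H) (congruenceM H _ (rep_proj x)) _.
by rewrite ![(x * _)%g]csmulC; exact: (congruenceM H _ (rep_proj y)).
Qed.

Fact quo_addC : commutative quo_add.
Proof. by move=> u v; rewrite /quo_add csaddC. Qed.

Fact quo_addA : associative quo_add.
Proof.
by move=> u v w; rewrite -(repK u) -(repK v) -(repK w) !quo_addE csaddA.
Qed.

Fact quo_mulC : commutative quo_mul.
Proof. by move=> u v; rewrite /quo_mul csmulC. Qed.

Fact quo_mulA : associative quo_mul.
Proof.
by move=> u v w; rewrite -(repK u) -(repK v) -(repK w) !quo_mulE mulgA.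
Qed.

Fact quo_mulDl : left_distributive quo_mul quo_add.
Proof.
move=> u v w; rewrite -(repK u) -(repK v) -(repK w).
by rewrite !(quo_addE, quo_mulE) csmulDl.
Qed.

Fact quo_inhabited : inhabited Q.
Proof. by have [x] := @csemiring_inhabited S; split; exact: (proj x). Qed.

HB.instance Definition _ := Algebra.isAddSemigroup.Build Q quo_addC quo_addA.
HB.instance Definition _ := isSemigroup.Build Q quo_mulA.
HB.instance Definition _ :=
  isCommutativeSemiring.Build Q quo_inhabited quo_mulC quo_mulDl.

Lemma proj_morphism : semiring_morphism proj.
Proof. by split=> x y; symmetry; [exact: quo_addE | exact: quo_mulE]. Qed.

Lemma projD x y : proj (x + y) = proj x + proj y.
Proof. exact: proj_morphism.1. Qed.

Lemma projM x y : proj (x * y)%g = (proj x * proj y)%g.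
Proof. exact: proj_morphism.2. Qed.

Lemma quo_fg : finitely_generated S -> finitely_generated Q.
Proof.
by apply: (fg_surj proj_morphism) => u; exists (rep u); rewrite repK.
Qed.

Lemma quo_unit e : is_unit e -> is_unit (proj e).
Proof.
by move=> [_ ue]; split=> // u _; rewrite -(repK u) -projM ue.
Qed.

Lemma quo_divisible : additively_divisible S -> additively_divisible Q.
Proof.
move=> Sd u n n0; have [b Hb] := Sd (rep u) n n0.
exists (proj b); rewrite -morph_nsum; last exact: proj_morphism.
by rewrite -Hb repK.
Qed.

End Quotient.

(** * Subsemirings as semirings in their own right *)

Definition subsemiring_type (S : csemiringType) (D : set S)
  (H : subsemiring D) : Type := {x : S | x \in D}.

Section Subsemiring.
Variables (S : csemiringType) (D : set S) (H : subsemiring D).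
Local Notation T := (subsemiring_type H).

HB.instance Definition _ := Choice.on T.

Fact subsr_addP (x y : T) : val x + val y \in D.
Proof.
by apply: mem_set; case: H => _ HD _; apply: HD; apply/set_mem/valP.
Qed.

Fact subsr_mulP (x y : T) : (val x * val y)%g \in D.
Proof.
by apply: mem_set; case: H => _ _ HM; apply: HM; apply/set_mem/valP.
Qed.

Definition subsr_add (x y : T) : T := exist (fun x => x \in D) _ (subsr_addP x y).
Definition subsr_mul (x y : T) : T := exist (fun x => x \in D) _ (subsr_mulP x y).

Fact subsr_addC : commutative subsr_add.
Proof. by move=> x y; apply: val_inj; rewrite /= csaddC. Qed.

Fact subsr_addA : associative subsr_add.
Proof. by move=> x y z; apply: val_inj; rewrite /= csaddA. Qed.

Fact subsr_mulC : commutative subsr_mul.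
Proof. by move=> x y; apply: val_inj; rewrite /= csmulC. Qed.

Fact subsr_mulA : associative subsr_mul.
Proof. by move=> x y z; apply: val_inj; rewrite /= mulgA. Qed.

Fact subsr_mulDl : left_distributive subsr_mul subsr_add.
Proof. by move=> x y z; apply: val_inj; rewrite /= csmulDl. Qed.

Fact subsr_inhabited : inhabited T.
Proof. by have [[x Dx] _ _] := H; split; exists x; apply: mem_set. Qed.

HB.instance Definition _ := Algebra.isAddSemigroup.Build T subsr_addC subsr_addA.
HB.instance Definition _ := isSemigroup.Build T subsr_mulA.
HB.instance Definition _ :=
  isCommutativeSemiring.Build T subsr_inhabited subsr_mulC subsr_mulDl.

Lemma subsr_mem (x : T) : D (val x). Proof. by apply: set_mem; apply: valP. Qed.

End Subsemiring.

(** * The implications among (A), (A1), (B), (B1), (B2), and (C1) => (C) *)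

Section TorsionQuotient.
Variable S : csemiringType.
Implicit Types a b c : S.

Definition torsion_rel : rel S :=
  fun a b => `[< exists2 n, (0 < n)%N & nsum n a = nsum n b >].

Lemma torsion_congruence : congruence torsion_rel.
Proof.
split.
- by move=> a; apply/asboolP; exists 1%N.
- by move=> a b; apply/asboolP/asboolP => -[n n0 E]; exists n.
- move=> b a c /asboolP[m m0 Em] /asboolP[n n0 En]; apply/asboolP.
  exists (m * n)%N; first by rewrite muln_gt0 m0.
  by rewrite mulnC nsumM // Em nsumC // En -nsumC // -nsumM // mulnC nsumM // nsumC.
- move=> c a b /asboolP[n n0 E]; apply/asboolP; exists n => //.
  by rewrite !nsum_add E.
- move=> c a b /asboolP[n n0 E]; apply/asboolP; exists n => //.
  by rewrite !nsum_mull E.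
Qed.

Definition torsion_quotient := quotient_semiring torsion_congruence.
Definition tproj : S -> torsion_quotient := @proj _ _ torsion_congruence.

HB.instance Definition _ := CSemiring.on torsion_quotient.

Lemma tproj_eq a b :
  tproj a = tproj b <-> exists2 n, (0 < n)%N & nsum n a = nsum n b.
Proof. by rewrite proj_eq; split=> [/asboolP|] // ?; apply/asboolP. Qed.

Lemma tproj_nsum n a : tproj (nsum n a) = nsum n (tproj a).
Proof. exact: morph_nsum (proj_morphism torsion_congruence). Qed.

Lemma nsum_torsion_quotient_inj n (u v : torsion_quotient) :
  (0 < n)%N -> nsum n u = nsum n v -> u = v.
Proof.
move=> n0; rewrite -(repK u) -(repK v) -!/(tproj _) -!tproj_nsum.
move=> /tproj_eq[m m0]; rewrite -!nsumM // => E.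
by apply/tproj_eq; exists (m * n)%N; rewrite ?muln_gt0 ?m0.
Qed.

Lemma torsion_quotient_uniquely_divisible :
  additively_divisible S -> additively_uniquely_divisible torsion_quotient.
Proof.
move=> Sd u n n0; have [v Ev] := quo_divisible (H := torsion_congruence) Sd u n0.
by exists v; split=> // v' Ev'; apply: (nsum_torsion_quotient_inj n0); rewrite -Ev.
Qed.

(** Idempotence of the quotient says that each a has some n > 0 with n a = n (a + a). *)
Lemma torsion_quotient_idempotent :
  finitely_generated S -> additively_divisible S ->
  additively_idempotent torsion_quotient -> additively_idempotent S.
Proof.
move=> Sfg Sd Qi; apply: fg_torsion_idempotent => // a.
apply/tproj_eq; rewrite -[LHS]Qi; symmetry; exact: projD.
Qed.

End TorsionQuotient.

Lemma A1_imp_A : statement_A1 -> statement_A.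
Proof.
move=> A1 S Sfg Sd; apply: torsion_quotient_idempotent => //.
apply: A1; first exact: quo_fg.
exact: torsion_quotient_uniquely_divisible.
Qed.

Lemma posrat_frac (x : posrat) : exists a b : nat,
  [/\ (0 < a)%N, (0 < b)%N & val x * b%:R = a%:R].
Proof.
have x0 : 0 < val x := valP x.
exists `|numq (val x)|%N, `|denq (val x)|%N; split.
- by rewrite absz_gt0 numq_eq0 gt_eqF.
- by rewrite absz_gt0 denq_eq0.
rewrite !pmulrn !abszE gtr0_norm ?denq_gt0 // gtr0_norm ?numq_gt0 //.
by rewrite numqE.
Qed.

(** The embedding sends a / b to the t with b t = a e. Cancellation makes t unique and independent
    of the fraction; distinctness of the multiples of [e] makes the map injective. *)
Lemma posrat_copy_of_unit (T : csemiringType) (e : T) : is_unit e ->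
  (forall n (u v : T), (0 < n)%N -> nsum n u = nsum n v -> u = v) ->
  additively_divisible T ->
  (forall m n, (0 < m)%N -> (m < n)%N -> nsum m e <> nsum n e) ->
  exists Q : set T, posrat_copy Q /\ unit_of Q e.
Proof.
move=> [_ ue] canc Td einj.
have einj' m n : (0 < m)%N -> (0 < n)%N -> nsum m e = nsum n e -> m = n.
  move=> m0 n0 E; case: (ltngtP m n) => // [lt|lt]; exfalso.
  - exact: einj E.
  - exact: einj (esym E).
have /choice[f Hf] : forall x : posrat, exists t, forall a b, (0 < a)%N ->
    (0 < b)%N -> val x * b%:R = a%:R -> nsum b t = nsum a e.
  move=> x; have [a0 [b0 [a0p b0p E0]]] := posrat_frac x.
  have [t Et] := Td (nsum a0 e) b0 b0p.
  exists t => a b ap bp E; apply: (canc b0) => //.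
  rewrite nsumC // -Et -!nsumM //; congr (nsum _ e); apply/eqP.
  by rewrite -(eqr_nat rat) !natrM -E -E0 mulrCA [eqbRHS]mulrCA (mulrC b%:R).
(* One fraction for x suffices to recognise [f x]; both morphism laws follow from this. *)
have Hu x a b t : (0 < a)%N -> (0 < b)%N -> val x * b%:R = a%:R ->
    nsum b t = nsum a e -> f x = t.
  by move=> ap bp E Et; apply: (canc b) => //; rewrite Et; apply: Hf.
have fD : {morph f : x y / x + y}.
  move=> x y; have [a [b [ap bp Ex]]] := posrat_frac x.
  have [c [d [cp dp Ey]]] := posrat_frac y.
  apply: (Hu _ (a * d + b * c)%N (b * d)%N);
    rewrite ?addn_gt0 ?muln_gt0 ?ap ?bp ?cp ?dp //.
    by rewrite natrD !natrM /= mulrDl mulrA Ex mulrCA Ey.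
  rewrite nsum_add mulnC nsumM // (Hf x a b) // mulnC nsumM // (Hf y c d) //.
  by rewrite -!nsumM // -nsumD ?muln_gt0 ?ap ?bp ?cp ?dp // (mulnC d).
have fM : {morph f : x y / (x * y)%g}.
  move=> x y; have [a [b [ap bp Ex]]] := posrat_frac x.
  have [c [d [cp dp Ey]]] := posrat_frac y.
  apply: (Hu _ (a * c)%N (b * d)%N); rewrite ?muln_gt0 ?ap ?bp ?cp ?dp //.
    by rewrite !natrM /= mulrACA Ex Ey.
  by rewrite -nsum_mul // (Hf x a b) // (Hf y c d) // nsum_mul // ue.
have finj x y : f x = f y -> x = y.
  move=> E; have [a [b [ap bp Ex]]] := posrat_frac x.
  have [c [d [cp dp Ey]]] := posrat_frac y.
  have /einj' adbc : nsum (d * a) e = nsum (b * c) e.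
    by rewrite !nsumM // -(Hf x a b) // -(Hf y c d) // E nsumC.
  have {}adbc : (d * a)%N = (b * c)%N by apply: adbc; rewrite muln_gt0 ?dp ?bp.
  apply: val_inj; apply: (@mulIf _ (b * d)%:R).
    by rewrite pnatr_eq0 -lt0n muln_gt0 bp.
  by rewrite natrM mulrA Ex mulrCA Ey -!natrM mulnC adbc.
exists (range f); split.
- split; last first.
    exists f; split=> //; split=> [x _|x y _ _|_ [x _ <-]]; first by exists x.
      exact: finj.
    by exists x.
  split; first by exists (f (exist _ 1 ltr01)); eexists.
  - by move=> _ _ [x _ <-] [y _ <-]; exists (x + y); rewrite ?fD.
  - by move=> _ _ [x _ <-] [y _ <-]; exists (x * y)%g; rewrite ?fM.
- split; last by move=> x _; exact: ue.
  exists (exist _ 1 ltr01) => //.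
  by apply: (Hu _ 1%N 1%N) => //=; rewrite mulr1.
Qed.

Lemma B1_imp_B2 : statement_B1 -> statement_B2.
Proof.
move=> B1 S Sfg [e ue] Sd; have ueP := ue.
case: (pselect (exists m n, [/\ (0 < m)%N, (m < n)%N & nsum m e = nsum n e])).
- move=> [m [n [m0 mn E]]].
  have [k k0 Hk] := unit_multiples_torsion ue m0 mn E.
  exact: torsion_idempotent k0 Hk Sd.
move=> ninj; exfalso.
have tu : is_unit (tproj e) by apply: quo_unit.
apply: (B1 (torsion_quotient S) (tproj e)) => //; first exact: quo_fg.
apply: posrat_copy_of_unit => //.
- exact: nsum_torsion_quotient_inj.
- exact: quo_divisible.
(* Coinciding multiples in the quotient give k m e = k n e in [S], the case already settled. *)
move=> m n m0 mn; rewrite -!tproj_nsum => /tproj_eq[k k0].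
rewrite -!nsumM // ?(ltn_trans m0 mn) // => E; apply: ninj.
exists (k * m)%N, (k * n)%N.
by rewrite muln_gt0 k0 m0 ltn_pmul2l.
Qed.

(** Shifted by one, as 0 is not a positive rational. *)
Definition posrat_of_nat n : posrat := exist _ n.+1%:R (ltr0Sn rat n).

Lemma B2_imp_B1 : statement_B2 -> statement_B1.
Proof.
move=> B2 S e Sfg ue [Q [[_ [f [[fD fM] [fQ finj fsurj]]]] [Qe uQ]]].
have {}finj x y : f x = f y -> x = y by move=> ?; apply: finj; rewrite ?inE.
(* The preimage of [e] is idempotent, hence equal to 1. *)
have [x0 _ fx0] := fsurj e Qe.
have x01 : x0 = exist _ 1 ltr01.
  have : f (x0 * x0)%g = f x0 by rewrite fM fx0 uQ.
  move=> /finj /(congr1 val) /= E.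
  apply: val_inj => /=; apply: (@mulfI _ (val x0)); last by rewrite mulr1.
  by rewrite gt_eqF // (valP x0).
have fn n : f (posrat_of_nat n) = nsum n.+1 e.
  elim: n => [|n IH].
    by rewrite nsum1 -fx0 x01; congr f; apply: val_inj.
  rewrite nsumS -IH -fx0 -fD x01; congr f; apply: val_inj => /=.
  by rewrite -natr1 addrC.
(* Division by n + 1 is multiplication by the image of 1 / (n + 1). *)
have Sd : additively_divisible S.
  move=> a [//|n] _.
  have ip : 0 < n.+1%:R^-1 :> rat by rewrite invr_gt0.
  pose i : posrat := exist (fun q : rat => 0 < q) _ ip.
  exists (f i * a)%g.
  rewrite (nsum_unit _ _ ue) -fn mulgA -fM.
  have -> : (posrat_of_nat n * i)%g = x0.
    by rewrite x01; apply: val_inj; rewrite /= divff // pnatr_eq0.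
  by rewrite fx0 ue.2.
have Si : additively_idempotent S by apply: B2 => //; exists e.
have : f (x0 + x0) = f x0 by rewrite fD Si.
move=> /finj /(congr1 val) /= /eqP.
by rewrite x01.
Qed.

Lemma A_imp_B2 : statement_A -> statement_B2.
Proof. by move=> A S Sfg _; apply: A. Qed.

Lemma B_imp_B1 : statement_B -> statement_B1.
Proof. by move=> B S e Sfg _ [Q [cQ _]]; apply: (B S Sfg); exists Q. Qed.

Section ScaleQuotient.
Variables (S : csemiringType) (e : S).

(** For idempotent [e] the quotient is a copy of e S; as a quotient it inherits finite generation at
    once. *)
Definition scale_rel : rel S := fun x y => (e * x)%g == (e * y)%g.

Lemma scale_congruence : congruence scale_rel.
Proof.
split.
- by move=> x; rewrite /scale_rel.
- by move=> x y; rewrite /scale_rel eq_sym.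
- by move=> y x z /eqP xy /eqP yz; rewrite /scale_rel xy yz.
- by move=> z x y /eqP xy; rewrite /scale_rel !csmulDr xy.
- by move=> z x y /eqP xy; rewrite /scale_rel !mulgA xy.
Qed.

End ScaleQuotient.

Lemma B1_imp_B : statement_B1 -> statement_B.
Proof.
move=> B1 S Sfg [Q [[_ QD QM] [f [[fD fM] [fQ finj fsurj]]]]].
pose one : posrat := exist _ 1 ltr01; pose e := f one.
have one1 x : (one * x)%g = x by apply: val_inj; rewrite /= mul1r.
(* Multiplication by [e] fixes the copy of Q^+ pointwise, so the projection stays injective on
   it. *)
have ef x : (e * f x)%g = f x by rewrite -fM one1.
pose T := quotient_semiring (scale_congruence e).
pose p : S -> T := @proj _ _ (scale_congruence e).
have pD x y : p (x + y) = p x + p y by apply: projD.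
have pM x y : p (x * y)%g = (p x * p y)%g by apply: projM.
have pe : is_unit (p e).
  split=> // u _; rewrite -(repK u) -/(p _) -pM; apply/proj_eq.
  by rewrite /scale_rel mulgA ef.
apply: (B1 T (p e)) => //; first exact: quo_fg.
exists (range (p \o f)); split; last first.
  by split=> [|x _]; [exists one | apply: pe.2].
have gD : {morph p \o f : x y / x + y} by move=> x y /=; rewrite fD pD.
have gM : {morph p \o f : x y / (x * y)%g} by move=> x y /=; rewrite fM pM.
split.
  split; first by exists (p e); exists one.
  - by move=> _ _ [x _ <-] [y _ <-]; exists (x + y); rewrite ?gD.
  - by move=> _ _ [x _ <-] [y _ <-]; exists (x * y)%g; rewrite ?gM.
exists (p \o f); split=> //; split=> [x _|x y _ _ /proj_eq|_ [x _ <-]].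
- by exists x.
- by rewrite /scale_rel !ef => /eqP; apply: finj; rewrite ?inE.
- by exists x.
Qed.

(** To divide by n, multiply by the inverse of n e. *)
Lemma parasemifield_divisible (S : csemiringType) :
  parasemifield S -> additively_divisible S.
Proof.
move=> [e [ue inv _]] a n n0; have [y Ey] := inv (nsum n e).
by exists (y * a)%g; rewrite nsum_mull (nsum_unit _ y ue) Ey ue.2.
Qed.

Lemma B2_imp_C : statement_B2 -> statement_C.
Proof.
move=> B2 S pS Sfg; apply: B2 => //; last exact: parasemifield_divisible.
by have [e [ue _ _]] := pS; exists e.
Qed.

Lemma parasemifield_ideal_simple (S : csemiringType) :
  parasemifield S -> ideal_simple S.
Proof.
move=> [e [ue inv [x xe]]]; split; first by exists x, e.
move=> J [[y Jy] _ JM] _; apply/seteqP; split=> // z _.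
have [y' Ey] := inv y; rewrite -(ue.2 z I) -Ey -mulgA csmulC.
exact: JM.
Qed.

(** The element o would correspond to an invertible absorbing element, which collapses the group. *)
Lemma parasemifield_not_Ugroup (S : csemiringType) (G : zmodType) :
  parasemifield S -> ~ isomorphic S (Ugroup G).
Proof.
move=> [e [ue inv [x xe]]] [f [[_ fM] [g fK gK]]].
pose w := g None.
have absw y : (w * y)%g = w by apply: (can_inj fK); rewrite fM !gK.
have [w' Ew] := inv w; apply: xe.
by rewrite -(ue.2 x I) -Ew !absw.
Qed.

Lemma C1_imp_C : statement_C1 -> statement_C.
Proof.
move=> C1 S pS Sfg; have [e [ue _ _]] := pS.
case: (pselect (exists m n, [/\ (0 < m)%N, (m < n)%N & nsum m e = nsum n e])).
- move=> [m [n [m0 mn E]]].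
  have [k k0 Hk] := unit_multiples_torsion ue m0 mn E.
  exact: torsion_idempotent k0 Hk (parasemifield_divisible pS).
move=> ninj.
have Sinf : infinite_set [set: S].
  move=> fin; apply: infinite_nat.
  rewrite -(preimage_setT (fun n => nsum n.+1 e)); apply: finite_preimage fin.
  move=> m n _ _ E; case: (ltngtP m n) => // lt; case: ninj.
  - by exists m.+1, n.+1.
  - by exists n.+1, m.+1.
have [//|[G [_ _ iso]]] := C1 S Sfg Sinf (parasemifield_ideal_simple pS).
by case: (parasemifield_not_Ugroup pS iso).
Qed.

(** * Fields finitely generated as rings *)

Section PseudoDivision.
Variables (F : fieldType) (R : subringClosed F).
Implicit Types p q s t : {poly F}.

Lemma lead_coef_polyOver p : p \is a polyOver R -> lead_coef p \in R.
Proof. by move=> /polyOverP pR; rewrite lead_coefE. Qed.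

(** Pseudo-division: a power of the leading coefficient of [p] keeps quotient and remainder over
    [R]. *)
Lemma polyOver_pdiv p t :
  p \is a polyOver R -> t \is a polyOver R -> p != 0 ->
  exists N q s, [/\ q \is a polyOver R, s \is a polyOver R,
    lead_coef p ^+ N *: t = q * p + s & (size s < size p)%N].
Proof.
move=> pR tR p0; have [n] := ubnP (size t).
elim: n t tR => // n IH t tR; rewrite ltnS => tn.
have [lt|le] := ltnP (size t) (size p).
  by exists 0%N, 0, t; rewrite rpred0 tR lt expr0 scale1r mul0r add0r.
pose k := (size t - size p)%N.
pose q0 := lead_coef t *: 'X^k; pose t' := lead_coef p *: t - q0 * p.
have pt : (0 < size t)%N by rewrite (leq_trans _ le) // size_poly_gt0.
have q0R : q0 \is a polyOver R.
  by rewrite polyOverZ ?rpredX ?polyOverX ?lead_coef_polyOver.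
have t'R : t' \is a polyOver R.
  rewrite /t'; apply: rpredB; last exact: rpredM.
  by apply: polyOverZ => //; apply: lead_coef_polyOver.
have st' : (size t' <= (size t).-1)%N.
  apply/leq_sizeP => j; rewrite /t' /q0 -scalerAl coefB !coefZ coefXnM => jt.
  have kj : (k <= j)%N.
    by apply: leq_trans jt; rewrite /k -subn1 leq_sub2l // size_poly_gt0.
  have pp : (0 < size p)%N by rewrite size_poly_gt0.
  rewrite ltnNge kj /=; move: jt; rewrite leq_eqVlt => /predU1P[<-|jt].
    have -> : ((size t).-1 - k)%N = (size p).-1 by rewrite /k; lia.
    by rewrite -!lead_coefE mulrC subrr.
  have [tj pj] : (size t <= j)%N /\ (size p <= j - k)%N by rewrite /k; lia.
  by rewrite !nth_default // !mulr0 subr0.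
have [|N [q [s [qR sR E ss]]]] := IH t' t'R; first by lia.
exists N.+1, (q + lead_coef p ^+ N *: q0), s; split=> //.
  apply: rpredD => //; apply: polyOverZ => //.
  by apply: rpredX; apply: lead_coef_polyOver.
rewrite mulrDl -addrAC -E /t' scalerBr exprSr -scalerA.
by rewrite -[_ *: q0 * p]scalerAl subrK.
Qed.

End PseudoDivision.

Section Adjoin.
Variables (F : fieldType) (R : subringClosed F) (u : F).

Definition adjoin : {pred F} :=
  fun y => `[< exists2 p, p \is a polyOver R & y = p.[u] >].

Lemma adjoinP y :
  y \in adjoin <-> exists2 p, p \is a polyOver R & y = p.[u].
Proof. by split=> [/asboolP|?]; last apply/asboolP. Qed.

Fact adjoin_subring_closed : subring_closed adjoin.
Proof.
split.
- by apply/adjoinP; exists 1; rewrite ?rpred1 ?hornerC.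
- move=> _ _ /adjoinP[p pR ->] /adjoinP[q qR ->]; apply/adjoinP.
  by exists (p - q); rewrite ?rpredB // hornerD hornerN.
- move=> _ _ /adjoinP[p pR ->] /adjoinP[q qR ->]; apply/adjoinP.
  by exists (p * q); rewrite ?rpredM // hornerM.
Qed.

HB.instance Definition _ :=
  GRing.isSubringClosed.Build F adjoin adjoin_subring_closed.

Lemma adjoin_base x : x \in R -> x \in adjoin.
Proof. by move=> xR; apply/adjoinP; exists x%:P; rewrite ?polyOverC ?hornerC. Qed.

Lemma adjoin_gen : u \in adjoin.
Proof. by apply/adjoinP; exists 'X; rewrite ?polyOverX ?hornerX. Qed.

(** No monic polynomial is asked for: this is algebraicity over the fraction field of [R], not
    integrality. *)
Definition algebraic_elt :=
  exists p, [/\ p \is a polyOver R, p != 0 & p.[u] = 0].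

End Adjoin.

(* Kaplansky's Goldman domains ("G-domains"): the fraction field is [R[1/f]]. *)
Definition goldman (F : fieldType) (R : {pred F}) : Prop :=
  exists f, [/\ f \in R, f != 0 & forall r, r \in R -> r != 0 ->
    exists n, exists2 s, s \in R & r * s = f ^+ n].

Section Kaplansky.
Variables (F : fieldType) (R : subringClosed F) (u : F).

(** If [u] were transcendental, R[u] would be a polynomial ring, in which g X + 1 must divide a
    power of g although it is coprime to g and not constant. *)
Lemma goldman_adjoin_algebraic : goldman (adjoin R u) -> algebraic_elt R u.
Proof.
move=> [_ [/adjoinP[g gR ->] g0 Hg]]; apply: contrapT => nalg.
have inj p : p \is a polyOver R -> p.[u] = 0 -> p = 0.
  by move=> pR pu; apply/eqP/negP => /negP p0; apply: nalg; exists p.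
have {}g0 : g != 0 by apply: contraNneq g0 => ->; rewrite horner0.
pose d := g * 'X + 1%:P.
have dR : d \is a polyOver R by rewrite rpredD ?rpredM ?polyOverX ?polyOverC ?rpred1.
have sd : size d = (size g).+1 by rewrite size_MXaddC (negPf g0).
have d0 : d != 0 by rewrite -size_poly_gt0 sd.
have [||n [_ /adjoinP[s sR ->] E]] := Hg d.[u].
- by apply/adjoinP; exists d.
- by apply: contraNneq d0 => /inj ->.
have Eds : d * s = g ^+ n.
  apply/eqP; rewrite -subr_eq0; apply/eqP/inj.
    by rewrite rpredB ?rpredM ?rpredX.
  by rewrite hornerD hornerN hornerM E horner_exp subrr.
have cop : coprimep d (g ^+ n).
  apply: coprimep_expr; apply/Bezout_eq1_coprimepP; exists (1, - 'X) => /=.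
  by rewrite /d mul1r mulNr addrAC (mulrC g) subrr add0r.
have : gcdp d (g ^+ n) %= d by rewrite dvdp_gcd_idl // -Eds dvdp_mulr.
move=> /eqp_size; move: cop; rewrite coprimep_def => /eqP ->.
by rewrite sd => -[] /esym/eqP; rewrite size_poly_eq0 (negPf g0).
Qed.

Lemma algebraic_min_poly : algebraic_elt R u ->
  exists p, [/\ p \is a polyOver R, p != 0, p.[u] = 0 &
    forall q, q \is a polyOver R -> q.[u] = 0 -> (size q < size p)%N -> q = 0].
Proof.
move=> [p1 [p1R p10 p1u]].
pose P n := `[< exists p,
  [/\ p \is a polyOver R, p != 0, p.[u] = 0 & size p = n] >].
have exP : exists n, P n by exists (size p1); apply/asboolP; exists p1.
case: (ex_minnP exP) => n /asboolP[p [pR p0 pu sp]] minP.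
exists p; split=> // q qR qu; rewrite sp ltnNge; apply: contraNeq => q0.
by apply: minP; apply/asboolP; exists q.
Qed.

(* Euclid's algorithm against a minimal polynomial of [u]. *)
Lemma algebraic_multiple_in_base g : algebraic_elt R u ->
  g \is a polyOver R -> g.[u] != 0 ->
  exists b h, [/\ b \in R, b != 0, h \is a polyOver R & g.[u] * h.[u] = b].
Proof.
move=> /algebraic_min_poly[p [pR p0 pu minp]] gR g0.
(* Sizes of nonzero s, smaller than p, whose value at [u] is a multiple of g(u) in R[u]; a minimal
   one turns out to be constant. *)
pose P n := `[< exists s, [/\ s \is a polyOver R, s != 0, (size s < size p)%N,
  size s = n & exists2 h, h \is a polyOver R & g.[u] * h.[u] = s.[u]] >].
have exP : exists n, P n.
  have [N [q [s [qR sR E ss]]]] := polyOver_pdiv pR gR p0.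
  have Es : g.[u] * lead_coef p ^+ N = s.[u].
    by rewrite mulrC -hornerZ E hornerD hornerM pu mulr0 add0r.
  exists (size s); apply/asboolP; exists s; split=> //.
    apply: contraNneq g0 => s0; move: Es; rewrite s0 horner0 => /eqP.
    by rewrite mulf_eq0 expf_eq0 lead_coef_eq0 (negPf p0) andbF orbF.
  exists (lead_coef p ^+ N)%:P; last by rewrite hornerC.
  by rewrite polyOverC rpredX ?lead_coef_polyOver.
case: (ex_minnP exP) => n /asboolP[s [sR s0 ssp sn [h hR Eh]]] minP.
have [s1|s1] := leqP (size s) 1.
  exists s`_0, h; split=> //; first exact: (polyOverP sR).
    by move: s0; rewrite {1}(size1_polyC s1) polyC_eq0.
  by rewrite Eh {1}(size1_polyC s1) hornerC.
(* If s is not constant, the remainder of p by s is again such a multiple, so it vanishes by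
   minimality; then q is nonzero, kills [u] and is smaller than p. *)
have [N [q [s' [qR s'R E ss]]]] := polyOver_pdiv sR pR s0.
have [s'0|s'0] := eqVneq s' 0; last first.
  suff : (n <= size s')%N by rewrite -sn leqNgt ss.
  apply: minP; apply/asboolP; exists s'; split=> //; first exact: ltn_trans ssp.
  exists (- (q * h)); first by rewrite rpredN rpredM.
  rewrite hornerN hornerM mulrN mulrCA Eh; apply/eqP; rewrite eq_sym -subr_eq0 opprK.
  by rewrite addrC -hornerM -hornerD -E hornerZ pu mulr0.
move: E; rewrite s'0 addr0 => E.
have c0 : lead_coef s ^+ N != 0 by rewrite expf_neq0 ?lead_coef_eq0.
have q0 : q != 0.
  apply: contraNneq p0 => q0; move/eqP: E.
  by rewrite q0 mul0r scaler_eq0 (negPf c0).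
have : q = 0.
  apply: (minp q) => //.
    have /eqP : q.[u] * s.[u] = 0 by rewrite -hornerM -E hornerZ pu mulr0.
    rewrite mulf_eq0 => /orP[/eqP //|/eqP su].
    by move: s0; rewrite (minp s) ?eqxx.
  rewrite -(size_scale p c0) E size_mul //.
  move: s1 q0; rewrite -size_poly_gt0; move: (size q) (size s) => m k. lia.
by move=> q00; rewrite q00 eqxx in q0.
Qed.

(** With g(u) h(u) = b in [R] and a the leading coefficient of a minimal p, the element a b works
    for [R]. *)
Lemma goldman_descent : goldman (adjoin R u) -> goldman R.
Proof.
move=> Gu; have alg := goldman_adjoin_algebraic Gu.
have [_ [/adjoinP[g gR ->] g0 Hg]] := Gu.
have [b [h [bR b0 hR Ebh]]] := algebraic_multiple_in_base alg gR g0.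
have [p [pR p0 pu minp]] := algebraic_min_poly alg.
have aR := lead_coef_polyOver pR; set a := lead_coef p in aR.
have a0 : a != 0 by rewrite lead_coef_eq0.
exists (a * b); split; [by rewrite rpredM | by rewrite mulf_neq0 |].
move=> r rR r0; have [n [_ /adjoinP[t tR ->] E]] := Hg r (adjoin_base u rR) r0.
have thR : t * h ^+ n \is a polyOver R by rewrite rpredM ?rpredX.
have [N [q [s [qR sR Es ss]]]] := polyOver_pdiv pR thR p0.
(* From r t(u) = g(u)^n, multiplying by h(u)^n gives b^n; reducing t h^n modulo p costs a^N. *)
have Esu : r * s.[u] = a ^+ N * b ^+ n.
  have : (a ^+ N *: (t * h ^+ n)).[u] = s.[u].
    by rewrite Es hornerD hornerM pu mulr0 add0r.
  rewrite hornerZ hornerM horner_exp => <-.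
  by rewrite mulrCA (mulrA r) E -exprMn Ebh.
(* This polynomial vanishes at [u] and is smaller than p. Its constant coefficient moves the
   relation from R[u] to [R]. *)
have : r *: s - (a ^+ N * b ^+ n)%:P = 0.
  apply: minp.
  - by rewrite rpredB ?polyOverZ ?polyOverC ?rpredM ?rpredX.
  - by rewrite hornerD hornerN hornerZ hornerC Esu subrr.
  - rewrite (leq_ltn_trans (size_polyD _ _)) // size_polyN gtn_max.
    rewrite size_scale // ss (leq_ltn_trans (size_polyC_leq1 _)) //.
    exact: root_size_gt1 p0 (introT eqP pu).
move=> /(congr1 (fun w : {poly F} => w`_0)).
rewrite coefB coefZ coefC /= coef0 => /eqP; rewrite subr_eq0 => /eqP Er.
exists (N + n)%N, (s`_0 * (a ^+ n * b ^+ N)).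
  by rewrite !rpredM ?rpredX ?(polyOverP sR).
by rewrite (mulrA r) Er exprMn !exprD; ring.
Qed.

(** In a finite [R] the leading coefficient of p is a root of unity, so division by p is possible
    over [R] and every element of R[u] is a remainder evaluated at [u]. *)
Lemma finite_adjoin : algebraic_elt R u ->
  finite_set [set x | x \in R] -> finite_set [set x | x \in adjoin R u].
Proof.
move=> [p [pR p0 pu]] finR.
have aR := lead_coef_polyOver pR; set a := lead_coef p in aR.
have a0 : a != 0 by rewrite lead_coef_eq0.
have [k k0 ak] : exists2 k, (0 < k)%N & a ^+ k = 1.
  apply: contrapT => nk; apply: infinite_nat.
  have -> : [set: nat] = (fun n => a ^+ n) @^-1` [set x | x \in R].
    by apply/seteqP; split=> // n _ /=; rewrite rpredX.
  apply: finite_preimage finR => m n _ _ E.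
  wlog mn : m n E / (m < n)%N => [W|].
    by case: (ltngtP m n) => // lt; [apply: W | apply/esym/W].
  case: nk; exists (n - m)%N; first by rewrite subn_gt0.
  apply: (mulfI (expf_neq0 m a0)).
  by rewrite -exprD subnKC ?mulr1 // ltnW.
(* Coefficient lists rather than polynomials, so that finiteness follows by induction along Horner's
   scheme. *)
pose V m := [set horner_rec l u | l in
  [set l : seq F | all (mem R) l /\ (size l <= m)%N]].
have finV m : finite_set (V m).
  elim: m => [|m IH].
    apply: sub_finite_set (finite_set1 0) => _ [l [_ ls] <-] /=.
    by move: ls; rewrite leqn0 => /nilP ->.
  have fin' := finite_image2 (fun c v => v * u + c) finR IH.
  have : finite_set ([set 0] `|`
      [set v * u + c | c in [set x | x \in R] & v in V m]).
    by rewrite finite_setU; split=> //; apply: finite_set1.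
  apply: sub_finite_set => _ [[|c l] /= [lR ls] <-]; first by left.
  move: lR => /andP[cR lR]; right; exists c => //; exists (horner_rec l u) => //.
  by exists l.
apply: sub_finite_set (finV (size p)) => _ /adjoinP[t tR ->].
have [N [q [s [qR sR Es ss]]]] := polyOver_pdiv pR tR p0.
pose c := a ^+ (k.-1 * N).
have ca : c * a ^+ N = 1.
  by rewrite -exprD -mulSnr prednK // exprM ak expr1n.
exists (c *: s); last first.
  have : c * (a ^+ N *: t).[u] = c * s.[u].
    by rewrite Es hornerD hornerM pu mulr0 add0r.
  by rewrite hornerZ mulrA ca mul1r => ->; rewrite -hornerZ.
split; last by rewrite ltnW // (leq_ltn_trans (size_scale_leq _ _)).
have : c *: s \is a polyOver R by rewrite polyOverZ ?rpredX.
by [].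
Qed.

End Kaplansky.

Section PrimeRing.
Variable F : fieldType.

Definition prime_ring : {pred F} := fun y => `[< exists z : int, y = z%:~R >].

Fact prime_ring_subring_closed : subring_closed prime_ring.
Proof.
split; first by apply/asboolP; exists 1.
- move=> _ _ /asboolP[x ->] /asboolP[y ->]; apply/asboolP.
  by exists (x - y); rewrite rmorphB.
- move=> _ _ /asboolP[x ->] /asboolP[y ->]; apply/asboolP.
  by exists (x * y); rewrite rmorphM.
Qed.

HB.instance Definition _ :=
  GRing.isSubringClosed.Build F prime_ring prime_ring_subring_closed.

(** In characteristic 0 a prime exceeding |f| could not divide a power of f. *)
Lemma goldman_prime_ring_finite :
  goldman prime_ring -> finite_set [set x | x \in prime_ring].
Proof.
move=> [_ [/asboolP[f ->] f0 Hf]].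
have [n n0 En] : exists2 n : nat, (0 < n)%N & n%:R = 0 :> F.
  have [q ltq pq] := prime_above `|f|%N.
  have [q0|q0] := eqVneq (q%:R : F) 0; first by exists q => //; exact: prime_gt0.
  have [|m [_ /asboolP[s ->] E]] := Hf q%:R _ q0.
    by apply/asboolP; exists q%:Z.
  (* d vanishes in [F] but not in the integers, as q does not divide f^m. *)
  pose d : int := q%:Z * s - f ^+ m; exists `|d|%N.
    rewrite absz_gt0 subr_eq0; apply/eqP => /(congr1 absz).
    rewrite abszM abszX /= => Em.
    have : (q %| `|f| ^ m)%N by rewrite -Em dvdn_mulr.
    rewrite Euclid_dvdX // => /andP[/dvdn_leq qf _].
    have fn0 : (0 < `|f|)%N.
      by rewrite absz_gt0; apply: contraNneq f0 => ->; rewrite rmorph0.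
    by move: (qf fn0); rewrite leqNgt ltq.
  have : d%:~R = 0 :> F.
    by rewrite rmorphB rmorphM rmorphXn /= E subrr.
  case: (intP d) => [//|k|k]; rewrite /= ?abszN //.
  by rewrite rmorphN => /eqP; rewrite oppr_eq0 => /eqP.
have -> : [set x | x \in prime_ring] =
    [set x%:R | x in [set x : nat | (x < n)%N]].
  apply/seteqP; split=> [_ /asboolP[z ->]|_ [x _ <-]] /=; last first.
    by apply/asboolP; exists x%:Z.
  have nz : n%:Z != 0 by rewrite eqz_nat -lt0n.
  have zn : `|(z %% n)%Z|%N%:Z = (z %% n)%Z by rewrite gez0_abs ?modz_ge0.
  exists `|(z %% n)%Z|%N; first by rewrite -ltz_nat zn ltz_pmod.
  rewrite -[LHS]/((`|(z %% n)%Z|%N : int)%:~R) zn [in RHS](divz_eq z n).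
  by rewrite [RHS]intrD intrM -(pmulrn _ n) En mulr0 add0r.
apply: finite_image; exact: finite_II.
Qed.

End PrimeRing.

(** Along the tower of adjunctions from [R] to [F] the Goldman property descends from [F], making
    each step algebraic, and finiteness then climbs from [R]. *)
Lemma goldman_tower (F : fieldType) (s : seq F) (R : subringClosed F) :
  (forall R' : subringClosed F, {subset R <= R'} -> {subset s <= R'} ->
     forall x, x \in R') ->
  goldman R /\ (finite_set [set x | x \in R] -> finite_set [set: F]).
Proof.
elim: s R => [|u s IH] R HR.
  have Rall x : x \in R by apply: HR.
  split.
    exists 1; split; rewrite ?oner_neq0 // => r _ r0; exists 0%N, r^-1 => //.
    by rewrite divff.
  by apply: sub_finite_set => x _; apply: Rall.
have [|Gu Fu] := IH (adjoin R u).
  move=> R' RR' sR'; apply: HR => x; first by move=> /(adjoin_base u) /RR'.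
  by rewrite inE => /predU1P[->|/sR' //]; apply: RR'; apply: adjoin_gen.
split; first exact: goldman_descent Gu.
by move=> finR; apply/Fu/finite_adjoin => //; apply: goldman_adjoin_algebraic.
Qed.

Lemma fg_field_finite (F : fieldType) (s : seq F) :
  (forall R : subringClosed F, {subset s <= R} -> forall x, x \in R) ->
  finite_set [set: F].
Proof.
move=> Hs; have [|G Fin] := goldman_tower (s := s) (R := @prime_ring F).
  by move=> R' _; apply: Hs.
exact/Fin/goldman_prime_ring_finite.
Qed.

(** * Semifields and a saturated parasemifield inside them *)

(** Induction on k: finitely many tails bound all tails from below. Each comes with a head [h t];
    vectors whose head is too small for it lie in one of the finitely many slices with head below
    [N]. *)
Lemma dickson_lemma k (A : set (seq nat)) :
  (forall a, A a -> size a = k) ->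
  exists l : seq (seq nat), (forall b, b \in l -> A b) /\
    forall a, A a -> exists2 b, b \in l & all2 leq b a.
Proof.
elim: k A => [|k IH] A Ak.
  have [A0|nA0] := pselect (A [::]); last first.
    by exists [::]; split=> // a Aa; case: nA0; rewrite -(size0nil (Ak a Aa)).
  exists [:: [::]]; split=> [b|a /Ak/size0nil ->]; first by rewrite inE => /eqP ->.
  by exists [::]; rewrite ?inE.
have /choice[L HL] : forall i, exists l : seq (seq nat),
    (forall t, t \in l -> A (i :: t)) /\
    forall t, A (i :: t) -> exists2 t', t' \in l & all2 leq t' t.
  by move=> i; apply: (IH (fun t => A (i :: t))) => t /Ak [].
have [l [lB Hl]] : exists l : seq (seq nat),
    (forall t, t \in l -> exists i, A (i :: t)) /\
    forall t, (exists i, A (i :: t)) -> exists2 t', t' \in l & all2 leq t' t.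
  by apply: (IH (fun t => exists i, A (i :: t))) => t [i /Ak []].
have /choice[h Hh] : forall t, exists i, t \in l -> A (i :: t).
  move=> t; have [/lB[i Ai]|tl] := boolP (t \in l); first by exists i.
  by exists 0%N.
pose N := \max_(t <- l) h t.
exists ([seq h t :: t | t <- l] ++
        flatten [seq [seq i :: t | t <- L i] | i <- iota 0 N]).
split=> [b|a Aa].
  rewrite mem_cat => /orP[/mapP[t tl ->]|/flatten_mapP[i _ /mapP[t tL ->]]].
    exact: Hh.
  exact: (HL i).1.
case: a Aa => [/Ak //|i t Ait].
have [t' t'l t't] := Hl t (ex_intro _ i Ait).
have [hi|ih] := leqP (h t') i.
  exists (h t' :: t'); last by rewrite /= hi.
  by rewrite mem_cat (map_f (fun t => h t :: t) t'l).
have [t'' t''L t''t] := (HL i).2 t Ait.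
exists (i :: t''); last by rewrite /= leqnn.
rewrite mem_cat; apply/orP; right; apply/flatten_mapP; exists i.
  by rewrite mem_iota add0n (leq_trans ih) // (@leq_bigmax_seq _ l xpredT h).
exact: map_f.
Qed.

Inductive sums (S : csemiringType) (M : set S) : S -> Prop :=
| sums1 x : M x -> sums M x
| sumsD x y : sums M x -> sums M y -> sums M (x + y).

Lemma sumsM (S : csemiringType) (M : set S) :
  (forall x y, M x -> M y -> M (x * y)%g) ->
  forall x y, sums M x -> sums M y -> sums M (x * y)%g.
Proof.
move=> MM x y Sx Sy; elim: Sx => [{}x Mx|x1 x2 _ IH1 _ IH2]; last first.
  by rewrite csmulDl; apply: sumsD.
elim: Sy => [{}y My|y1 y2 _ IH1 _ IH2]; first by apply/sums1/MM.
by rewrite csmulDr; apply: sumsD.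
Qed.

Section Monomials.
Variables (S : csemiringType) (e : S).
Hypothesis ue : is_unit e.
Implicit Types (s : seq S) (v : seq nat).

Let ul x : (e * x)%g = x. Proof. exact: ue.2. Qed.
Let ur x : (x * e)%g = x. Proof. by rewrite csmulC. Qed.

Definition pow (x : S) n : S := iter n (fun y => (x * y)%g) e.

Lemma powD x m n : pow x (m + n) = (pow x m * pow x n)%g.
Proof. by elim: m => [|m IH]; rewrite ?ul // addSn /= IH mulgA. Qed.

(** [v] is the exponent vector; a length mismatch truncates, whence the size hypotheses below. *)
Fixpoint monomial s v : S :=
  match s, v with
  | x :: s', n :: v' => (pow x n * monomial s' v')%g
  | _, _ => e
  end.

Lemma monomialM s v v' : size v = size s -> size v' = size s ->
  exists v'', [/\ size v'' = size s, sumn v'' = (sumn v + sumn v')%N &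
    monomial s v'' = (monomial s v * monomial s v')%g].
Proof.
elim: s v v' => [|x s IH] [|n v] [|n' v'] //=; first by exists [::].
move=> [sv] [sv']; have [v'' [sv'' Ev Em]] := IH v v' sv sv'.
exists ((n + n')%N :: v'') => /=; split.
- by rewrite sv''.
- by rewrite Ev addnACA.
- by rewrite Em powD csmulACA.
Qed.

Lemma monomial_leq s v v' : size v = size s -> all2 leq v' v ->
  exists v'', [/\ size v'' = size s, sumn v = (sumn v' + sumn v'')%N &
    monomial s v = (monomial s v' * monomial s v'')%g].
Proof.
elim: s v v' => [|x s IH] [|n v] [|n' v'] //=; first by exists [::].
move=> [sv] /andP[nn' vv']; have [v'' [sv'' Ev Em]] := IH v v' sv vv'.
exists ((n - n')%N :: v'') => /=; split.
- by rewrite sv''.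
- by rewrite Ev addnACA subnKC.
- by rewrite Em csmulACA -powD subnKC.
Qed.

Lemma monomial0 s v : sumn v = 0%N -> monomial s v = e.
Proof.
elim: s v => [|x s IH] [|n v] //= /eqP; rewrite addn_eq0 => /andP[/eqP -> /eqP v0].
by rewrite IH // ul.
Qed.

(** Leaving out the zero vector ensures that dividing by a monomial lowers the degree. *)
Definition monomials s : set S :=
  [set y | exists v, [/\ size v = size s, (0 < sumn v)%N & y = monomial s v]].

Lemma monomials_mul s x y :
  monomials s x -> monomials s y -> monomials s (x * y)%g.
Proof.
move=> [v [sv v0 ->]] [v' [sv' v'0 ->]].
have [v'' [sv'' Ev <-]] := monomialM sv sv'.
by exists v''; split=> //; rewrite Ev addn_gt0 v0.
Qed.

Lemma monomials_gen s x : x \in s -> monomials s x.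
Proof.
elim: s => // y s IH; rewrite inE => /predU1P[->|/IH[v [sv v0 ->]]].
- exists (1%N :: nseq (size s) 0%N); split=> //=; first by rewrite size_nseq.
  by rewrite monomial0 ?ur // sumn_nseq.
- by exists (0%N :: v); rewrite /= sv ul.
Qed.

End Monomials.

Lemma subsemiring_seq (S : csemiringType) (D : set S) (H : subsemiring D)
    (s : seq S) : (forall x, x \in s -> D x) ->
  exists t : seq (subsemiring_type H), [seq val x | x <- t] = s.
Proof.
elim: s => [|x s IH] Ds; first by exists [::].
have [|t Et] := IH; first by move=> y ys; apply: Ds; rewrite inE ys orbT.
have Dx : x \in D by apply/mem_set/Ds/mem_head.
by exists ((exist (fun x => x \in D) x Dx : subsemiring_type H) :: t); rewrite /= Et.
Qed.

(* By saturation and divisibility the monomials of [D] are the vectors of a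
   submonoid of [N^k] closed under subtraction, so that its finitely many
   minimal elements generate it. *)
Lemma saturated_subsemiring_fg (S : csemiringType) (e w : S) (D : set S)
    (H : subsemiring D) : is_unit e -> finitely_generated S ->
  (forall x, (w * x)%g = w) ->
  (forall x, w + x = w \/ w + x = x) -> ~ D w ->
  (forall x y, D x -> D (x * y)%g -> D y) ->
  (forall x y, x <> w -> D (x + y) -> D x) ->
  finitely_generated (subsemiring_type H).
Proof.
move=> ue /finitely_generatedP[s0 Hs0] wM wD nDw Ddiv Dsat.
pose s := [seq x <- s0 | x != w].
have span x : x = w \/ sums (monomials e s) x.
  move: x; apply: Hs0 => [x xs|x y Hx Hy|x y [->|Hx] [->|Hy]].
  - have [->|xw] := eqVneq x w; [by left | right; apply: sums1].
    by apply: monomials_gen => //; rewrite mem_filter xw.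
  - case: Hx Hy => [->|Hx] [->|Hy].
    + by case: (wD w) => ->; left.
    + by case: (wD y) => ->; [left | right].
    + by rewrite csaddC; case: (wD x) => ->; [left | right].
    + by right; apply: sumsD.
  - by left; rewrite wM.
  - by left; rewrite wM.
  - by left; rewrite csmulC wM.
  - by right; apply: sumsM => // a b; apply: monomials_mul.
(* By saturation the summands of an element of [D] lie in [D], except those equal to [w], which must
   be additively neutral there. *)
have spanD x : sums (monomials e s) x -> D x ->
    sums (monomials e s `&` D) x.
  elim=> [{}x Mx Dx|{}x y _ IHx _ IHy Dxy]; first exact: sums1.
  have [xw|xw] := pselect (x = w).
    by case: (wD y) Dxy => E; rewrite xw E // => Dy; apply: IHy.
  have Dx := Dsat _ _ xw Dxy.
  have [yw|yw] := pselect (y = w).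
    by case: (wD x) Dxy => E; rewrite yw csaddC E // => _; apply: IHx.
  apply: sumsD; [exact: IHx | apply: IHy].
  by apply: Dsat yw _; rewrite csaddC; apply: Dxy.
pose A : set (seq nat) :=
  [set v | [/\ size v = size s, (0 < sumn v)%N & D (monomial e s v)]].
have [|l [lA Hl]] := @dickson_lemma (size s) A; first by move=> v [].
have [|g Eg] := @subsemiring_seq S D H [seq monomial e s v | v <- l].
  by move=> _ /mapP[v /lA[_ _ Dv] ->].
apply/finitely_generatedP; exists g => P Pg PD PM.
(* Transfers [P] to [S], where the monomials live. *)
pose P' x := D x /\ forall y : subsemiring_type H, val y = x -> P y.
have P'A v : A v -> P' (monomial e s v).
  have [n] := ubnP (sumn v); elim: n v => // n IH v; rewrite ltnS => vn Av.
  have [sv v0 Dv] := Av; split=> // y Ey.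
  have [b bl bv] := Hl v Av; have [sb b0 Db] := lA b bl.
  have [c [sc Ec Em]] := monomial_leq ue sv bv.
  have Pb (z : subsemiring_type H) : val z = monomial e s b -> P z.
    move=> Ez; apply: Pg; rewrite -(mem_map val_inj) Eg Ez.
    exact: map_f.
  (* Either the cofactor is [e] and the monomial is itself a generator, or it is a monomial of [D]
     of smaller degree. *)
  have [c0|c0] := posnP (sumn c).
    by apply: Pb; rewrite Ey Em (monomial0 ue _ c0) csmulC ue.2.
  have Dc : D (monomial e s c) by apply: (Ddiv _ _ Db); rewrite -Em.
  have [|//|_ Pc] := IH c.
    by apply: leq_trans vn; rewrite Ec -addn1 addnC leq_add2r.
  pose mk x Dx : subsemiring_type H :=
    exist (fun x => x \in D) x (@mem_set _ D x Dx).
  have -> : y = (mk _ Db * mk _ Dc)%g by apply: val_inj; rewrite Ey Em.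
  by apply: PM; [apply: Pb | apply: Pc].
have P'S x : sums (monomials e s `&` D) x -> P' x.
  elim=> [{}x [[v [sv v0 ->]] Dv]|{}x y _ [Dx Px] _ [Dy Py]]; first exact: P'A.
  split; first by have [_ HD _] := H; apply: HD.
  move=> z Ez.
  pose mk x Dx : subsemiring_type H :=
    exist (fun x => x \in D) x (@mem_set _ D x Dx).
  have -> : z = mk _ Dx + mk _ Dy by apply: val_inj; rewrite Ez.
  by apply: PD; [apply: Px | apply: Py].
move=> x; have Dx := subsr_mem x.
have [xw|Mx] := span (val x); first by rewrite xw in Dx.
by apply: (P'S (val x) _).2 => //; apply: spanD.
Qed.

(** A group with an absorbing element; [w] may be an additive zero or additively absorbing. *)
Record semifield (S : csemiringType) (w e : S) : Prop := Semifield {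
  semifield_unit : is_unit e;
  semifield_absorbing : forall x, (w * x)%g = w;
  semifield_inv : forall x, x <> w -> exists y, (x * y)%g = e;
  semifield_neq : e <> w }.

Section Semifield.
Variables (S : csemiringType) (w e : S).
Hypothesis sf : semifield w e.

Let ue := semifield_unit sf.
Let wM := semifield_absorbing sf.
Let inv := semifield_inv sf.
Let ew := semifield_neq sf.
Let ul x : (e * x)%g = x. Proof. exact: ue.2. Qed.
Let ur x : (x * e)%g = x. Proof. by rewrite csmulC. Qed.

Lemma semifield_mul_neq x y : x <> w -> y <> w -> (x * y)%g <> w.
Proof.
move=> /inv[x' Ex] yw E; apply: yw.
by rewrite -(ul y) -Ex csmulC mulgA (csmulC y) E wM.
Qed.

Lemma semifield_inv_neq x y : (x * y)%g = e -> y <> w.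
Proof. by move=> E yw; apply: ew; rewrite -E yw csmulC wM. Qed.

(* [{g | g <= e}] for the order induced by addition: the quotients of its
   elements form a subgroup stable under addition, even when [w] is a top. *)
Definition below_unit : set S := [set g | g <> w /\ exists b, g + b = e].

Definition below_unit_quotients : set S :=
  [set y | exists g h, [/\ below_unit g, below_unit h & (y * h)%g = g]].

Local Notation P := below_unit.
Local Notation D := below_unit_quotients.

Hypotheses (wD : forall x, w + x = w \/ w + x = x) (two : e + e <> w)
  (sumP : forall p q, P p -> P q -> p + q <> w).

(** The half k satisfies k + k = e. It rescales a sum of two elements below [e] to one below [e]. *)
Lemma below_unit_half : exists2 k, P k & ((e + e) * k)%g = e.
Proof.
have [k Ek] := inv two; exists k => //; split; first exact: semifield_inv_neq Ek.
by exists k; rewrite -Ek csmulDl !ul.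
Qed.

Lemma below_unitM g h : P g -> P h -> P (g * h)%g.
Proof.
move=> [gw [b Eb]] [hw [c Ec]]; split; first exact: semifield_mul_neq.
(* Expand e = (g + b) (h + c). *)
exists ((g * c)%g + (b * (h + c))%g).
by rewrite csaddA -csmulDr Ec -csmulDl Eb ul.
Qed.

Lemma quotients_neq y : D y -> y <> w.
Proof. by move=> [g [h [[gw _] _ E]]] yw; apply: gw; rewrite -E yw wM. Qed.

Lemma quotients_unit : D e.
Proof. by have [k Pk _] := below_unit_half; exists k, k; rewrite ul. Qed.

Lemma quotientsM x y : D x -> D y -> D (x * y)%g.
Proof.
move=> [g [h [Pg Ph E]]] [g' [h' [Pg' Ph' E']]].
exists (g * g')%g, (h * h')%g; split; try exact: below_unitM.
by rewrite csmulACA E E'.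
Qed.

Lemma quotientsV x y : D x -> (x * y)%g = e -> D y.
Proof.
move=> [g [h [Pg Ph E]]] Ey; exists h, g; split=> //.
by rewrite -E mulgA (csmulC y) Ey ul.
Qed.

Lemma quotientsD x y : D x -> D y -> D (x + y).
Proof.
move=> [g [h [Pg Ph E]]] [g' [h' [Pg' Ph' E']]].
have [k Pk Ek] := below_unit_half.
have Pp := below_unitM Pg Ph'; have Pq := below_unitM Pg' Ph.
have Nk := Pk.1.
(* The usual sum of fractions, halved above and below so that the numerator stays below [e]. *)
exists (((g * h')%g + (g' * h)%g) * k)%g, ((h * h') * k)%g; split.
- split; first by apply: semifield_mul_neq => //; apply: sumP.
  have [_ [b Eb]] := Pp; have [_ [c Ec]] := Pq.
  by exists ((b + c) * k)%g; rewrite -csmulDl csaddACA Eb Ec.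
- by do 2![apply: below_unitM => //].
- rewrite mulgA; congr (_ * k)%g; rewrite csmulDl mulgA E.
  by rewrite (csmulC h) mulgA E'.
Qed.

(** If (x + y) h is below [e], so is its summand x h. *)
Lemma quotients_saturated x y : x <> w -> D (x + y) -> D x.
Proof.
move=> xw [g [h [[gw [c Ec]] Ph E]]]; exists (x * h)%g, h; split=> //.
split; first by apply: semifield_mul_neq => //; exact: Ph.1.
by exists ((y * h)%g + c); rewrite csaddA -csmulDl E.
Qed.

Lemma quotients_subsemiring : subsemiring D.
Proof.
split; [by exists e; apply: quotients_unit | exact: quotientsD | exact: quotientsM].
Qed.

Lemma semifield_idempotent :
  statement_C -> finitely_generated S -> e + e = e.
Proof.
(* The assumption e + e <> e supplies the nontriviality that a parasemifield requires. *)
move=> C Sfg; apply: contrapT => ee.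
pose T := subsemiring_type quotients_subsemiring.
have Tfg : finitely_generated T.
  apply: saturated_subsemiring_fg ue Sfg wM wD _ _ quotients_saturated.
    by move/quotients_neq.
  move=> x y Dx Dxy; have [x' Ex] := inv (quotients_neq Dx).
  have -> : y = (x' * (x * y))%g by rewrite mulgA (csmulC x') Ex ul.
  by apply: quotientsM Dxy; apply: quotientsV Ex.
pose mk x Dx : T := exist (fun x => x \in D) x (@mem_set _ D x Dx).
have De := quotients_unit.
have pT : parasemifield T.
  exists (mk _ De); split.
  - by split=> // x _; apply: val_inj; apply: ul.
  - move=> x; have Dx := subsr_mem x; have [y Ey] := inv (quotients_neq Dx).
    by exists (mk _ (quotientsV Dx Ey)); apply: val_inj.
  - by exists (mk _ (quotientsD De De)) => /(congr1 val).
by apply: ee; have /(congr1 val) := C T pT Tfg (mk _ De).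
Qed.

End Semifield.

(** * Ideal-simple semirings *)

Section Inverse.
Variables (S : csemiringType) (w e : S) (sf : semifield w e).

Fact semifield_inv_ex x :
  exists y, if x == w then y == w else (x * y)%g == e.
Proof.
have [xw|/eqP/(semifield_inv sf)[y /eqP Ey]] := eqVneq x w; first by exists w.
by exists y.
Qed.

(** The value [w] at [w] matches the field convention that 0 is its own inverse. *)
Definition sinv x : S := xchoose (semifield_inv_ex x).

Fact sinv_spec x : if x == w then sinv x == w else (x * sinv x)%g == e.
Proof. exact: xchooseP (semifield_inv_ex x). Qed.

Lemma sinv0 : sinv w = w.
Proof. by have := sinv_spec w; rewrite eqxx => /eqP. Qed.

Lemma sinvP x : x != w -> (x * sinv x)%g = e.
Proof. by move=> /negPf xw; have := sinv_spec x; rewrite xw => /eqP. Qed.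

End Inverse.

Definition unit_group (S : csemiringType) (w e : S) (sf : semifield w e) : Type :=
  {x : S | x != w}.

Section UnitGroup.
Variables (S : csemiringType) (w e : S) (sf : semifield w e).
Local Notation G := (unit_group sf).

HB.instance Definition _ := Choice.on G.

Definition ug_mk (x : S) (xw : x != w) : G := exist (fun x => x != w) x xw.

Fact ug_mulP (x y : G) : (val x * val y)%g != w.
Proof.
by apply/eqP/(semifield_mul_neq sf); apply/eqP;
  [exact: (valP x) | exact: (valP y)].
Qed.

Fact ug_oneP : e != w.
Proof. exact/eqP/(semifield_neq sf). Qed.

Fact ug_invP (x : G) : sinv sf (val x) != w.
Proof. by apply/eqP/(semifield_inv_neq sf)/(sinvP sf (valP x)). Qed.

Definition ug_mul (x y : G) : G := ug_mk (ug_mulP x y).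
Definition ug_one : G := ug_mk ug_oneP.
Definition ug_inv (x : G) : G := ug_mk (ug_invP x).

Fact ug_mulA : associative ug_mul.
Proof. by move=> x y z; apply: val_inj; rewrite /= mulgA. Qed.

Fact ug_mulC : commutative ug_mul.
Proof. by move=> x y; apply: val_inj; rewrite /= csmulC. Qed.

Fact ug_mul1 : left_id ug_one ug_mul.
Proof. by move=> x; apply: val_inj; rewrite /= (semifield_unit sf).2. Qed.

Fact ug_mulV : left_inverse ug_one ug_inv ug_mul.
Proof.
by move=> x; apply: val_inj; rewrite /= csmulC (sinvP sf (valP x)).
Qed.

HB.instance Definition _ :=
  GRing.isZmodule.Build G ug_mulA ug_mulC ug_mul1 ug_mulV.

Hypothesis addw : forall x y : S, x + y = w.

Lemma constant_semifield_isomorphic : isomorphic S (Ugroup G).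
Proof.
pose f (x : S) : Ugroup G := insub x.
pose g (o : Ugroup G) : S := if o is Some x then val x else w.
have fw : f w = None by rewrite /f insubF // eqxx.
have fS (x : G) : f (val x) = Some x by rewrite /f valK.
have fP x : x = w \/ exists y : G, x = val y.
  by have [->|xw] := eqVneq x w; [left | right; exists (ug_mk xw)].
exists f; split; last first.
  exists g => [x|[x|//]]; last exact: fS.
  by case: (fP x) => [->|[y ->]]; rewrite ?fw ?fS.
split=> x y; first by rewrite addw fw.
have wM := semifield_absorbing sf.
case: (fP x) => [->|[x' ->]]; first by rewrite wM fw.
case: (fP y) => [->|[y' ->]]; first by rewrite csmulC wM fw fS.
by rewrite !fS; apply: (fS (x' + y')).
Qed.

(** Since every sum is [w], the elements other than [w] are products of generators other than
    [w]. *)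
Lemma unit_group_fg : finitely_generated S -> finitely_generated_group G.
Proof.
move=> /finitely_generatedP[s Hs]; exists [set x : G | val x \in s]; split.
  apply: (@finite_preimage _ _ [set` s] (val : G -> S)); last exact: finite_seq.
  by move=> x y _ _; apply: val_inj.
apply/seteqP; split=> // x _ A [[A0 AB] sA].
have AD y z : A y -> A z -> A (y + z).
  by move=> Ay Az; rewrite -[z]opprK; apply: (AB) => //; rewrite -sub0r; apply: (AB).
have HA y : y = w \/ exists2 z, A z & y = val z.
  move: y; apply: Hs => [y ys|y z _ _|y z].
  - have [->|yw] := eqVneq y w; [by left | right].
    by exists (ug_mk yw) => //; apply: sA.
  - by left.
  - move=> [->|[y' Ay' ->]]; first by left; rewrite (semifield_absorbing sf).
    move=> [->|[z' Az' ->]]; first by left; rewrite csmulC (semifield_absorbing sf).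
    by right; exists (y' + z') => //; apply: AD.
case: (HA (val x)) => [xw|[y Ay /val_inj ->//]].
by have := valP x; rewrite /= xw eqxx.
Qed.

Lemma unit_group_infinite : infinite_set [set: S] -> infinite_set [set: G].
Proof.
move=> Sinf fin; apply: Sinf.
have : finite_set ([set w] `|` [set val x | x in [set: G]]).
  by rewrite finite_setU; split; [apply: finite_set1 | apply: finite_image].
apply: sub_finite_set => x _.
by have [->|xw] := eqVneq x w; [left | right; exists (ug_mk xw)].
Qed.

End UnitGroup.

(** An alias of [S] that becomes a field with zero [w]; [neg] uses [==] so that [xchoose] can pick
    -1. *)
Definition semifield_field (S : csemiringType) (w e : S) (sf : semifield w e)
  (w0 : forall x, w + x = x) (neg : exists c, e + c == w) : Type := S.

Section SemifieldField.
Variables (S : csemiringType) (w e : S) (sf : semifield w e)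
  (w0 : forall x, w + x = x) (neg : exists c, e + c == w).
Local Notation F := (semifield_field sf w0 neg).

HB.instance Definition _ := Choice.on F.

Definition sff_opp (x : F) : F := ((xchoose neg : S) * (x : S))%g.

Fact sff_addN : @left_inverse F F F w sff_opp (fun x y => (x : S) + (y : S)).
Proof.
move=> x; rewrite /sff_opp -{2}((semifield_unit sf).2 x I) -csmulDl.
by rewrite csaddC (eqP (xchooseP neg)) (semifield_absorbing sf).
Qed.

HB.instance Definition _ := GRing.isZmodule.Build F
  (@csaddA S) (@csaddC S) w0 sff_addN.

Fact sff_mul1 : @left_id F F e (fun x y => ((x : S) * (y : S))%g).
Proof. by move=> x; apply: (semifield_unit sf).2. Qed.

Fact sff_one_neq0 : (e : F) != 0.
Proof. exact/eqP/(semifield_neq sf). Qed.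

HB.instance Definition _ := GRing.Zmodule_isComNzRing.Build F
  (@mulgA S) (@csmulC S) sff_mul1 (@csmulDl S) sff_one_neq0.

Fact sff_mulV (x : F) : x != 0 -> (sinv sf x : F) * x = 1.
Proof. by move=> x0; rewrite mulrC; apply: sinvP. Qed.

Fact sff_inv0 : (sinv sf (0 : F) : F) = 0.
Proof. exact: sinv0. Qed.

HB.instance Definition _ := GRing.ComNzRing_isField.Build F sff_mulV sff_inv0.

Lemma semifield_field_finite : finitely_generated S -> finite_set [set: S].
Proof.
move=> /finitely_generatedP[s Hs].
apply: (@fg_field_finite F s) => R sR x; move: x.
apply: Hs => [//|x y|x y] xR yR; [exact: (rpredD xR yR) | exact: (rpredM xR yR)].
Qed.

End SemifieldField.

Section NullMultiplication.
Variables (S : csemiringType) (w : S).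
Hypotheses (Sis : ideal_simple S) (mulw : forall x y : S, (x * y)%g = w).

Let ww : w + w = w.
Proof. by rewrite -{1 2}(mulw w w) -csmulDl mulw. Qed.

(** As long as n is at least q, replacing q of the summands by p of them lowers n. *)
Lemma nsum_repeat (a : S) p q : (0 < p)%N -> (p < q)%N ->
  nsum p a = nsum q a -> forall n, (0 < n)%N ->
  exists2 i, (i < q)%N & nsum n a = nsum i a.
Proof.
move=> p0 pq E n; have [m] := ubnP n; elim: m n => // m IH n.
rewrite ltnS => nm n0; have [nq|qn] := ltnP n q; first by exists n.
have [r0|r0] := posnP (n - q).
  by exists p; rewrite // E; congr (nsum _ a); lia.
have [||i iq Ei] := IH (p + (n - q))%N; [lia | lia |].
exists i => //; rewrite -Ei nsumD // E -nsumD ?subnKC //; lia.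
Qed.

(* Every additively closed set containing [w] is an ideal; compare those spanned
   by [a] and by [a + a]. *)
Lemma null_multiplication_finite : finite_set [set: S].
Proof.
have [a aw] : exists a, a <> w.
  have [[x [y [_ _ xy]]] _] := Sis; have [xw|] := pselect (x = w); last by exists x.
  by exists y => yw; apply: xy; rewrite xw yw.
(* The additive closure of [w] and k a, using w + w = w. *)
pose J k : set S := [set y | y = w \/ exists2 n, (0 < n)%N &
  y = nsum (k * n) a \/ y = w + nsum (k * n) a].
have Jid k : (0 < k)%N -> ideal (J k).
  move=> k0; split; [by exists w; left | | by move=> x y _; left; apply: mulw].
  have wJ y : J k y -> J k (w + y).
    move=> [->|[n n0 [->|->]]]; rewrite ?csaddA ?ww; first by left.
    - by right; exists n => //; right.
    - by right; exists n => //; right.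
  have nJ n y : (0 < n)%N -> J k y -> J k (nsum (k * n) a + y).
    move=> n0 [->|[m m0 Hm]]; first by rewrite csaddC; apply: wJ;
      right; exists n; auto.
    right; exists (n + m)%N; first by rewrite addn_gt0 n0.
    rewrite mulnDr nsumD ?muln_gt0 ?k0 //.
    by case: Hm => ->; [left | right; rewrite csaddCA].
  move=> x y [->|[n n0 [->|->]]] Jy; [exact: wJ | exact: nJ |].
  by rewrite -csaddA; apply/wJ/nJ.
have JT k : (0 < k)%N -> nsum k a <> w -> J k = [set: S].
  move=> k0 kw; apply: Sis.2; first exact: Jid.
  exists (nsum k a), w; split=> //; last by left.
  by right; exists 1%N => //; left; rewrite muln1.
(* If 2 a = w then 4 a = 2 a; otherwise [J 2] is everything and contains a, which is thus an even
   multiple of itself up to adding [w]. *)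
have [p [q [p0 pq Epq]]] : exists p q,
    [/\ (0 < p)%N, (p < q)%N & nsum p a = nsum q a].
  have [a2|a2] := pselect (nsum 2 a = w).
    by exists 2, 4; split=> //; rewrite (@nsumM _ 2 2) // a2 nsum2 ww.
  have : J 2 a by rewrite JT.
  move=> [//|[n n0 E]]; exists 1%N, (2 * n)%N; split=> //; first by lia.
  case: E => [//|E]; rewrite nsum1.
  (* In the case a = w + 2 n a, [w] is neutral on the multiples of a and drops out. *)
  have wa : w + a = a by rewrite [in LHS]E csaddA ww -E.
  have wn m : (0 < m)%N -> w + nsum m a = nsum m a.
    case: m => // m _; elim: m => [//|m IH].
    by rewrite nsumS csaddCA IH.
  by rewrite [LHS]E wn // muln_gt0.
pose A := [set nsum i a | i in [set i | (i < q)%N]].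
have finA : finite_set A by apply: finite_image; apply: finite_II.
have : finite_set ([set w] `|` (A `|` [set w + y | y in A])).
  by rewrite !finite_setU; do !split=> //; apply: finite_image.
apply: sub_finite_set => x _; have : J 1%N x by rewrite JT.
move=> [->|[n n0]]; first by left.
rewrite mul1n; have [i iq ->] := nsum_repeat p0 pq Epq n0.
move=> [->|->]; right; first by left; exists i.
by right; exists (nsum i a) => //; exists i.
Qed.

End NullMultiplication.

Section IdealSimple.
Variable S : csemiringType.
Hypothesis Sis : ideal_simple S.
Implicit Types a x y : S.

(** S a is an ideal, hence all of [S] or a single point. *)
Lemma principal_ideal_alternative a :
  (forall y, exists x, (x * a)%g = y) \/ exists w, forall x, (x * a)%g = w.
Proof.
pose J := [set (x * a)%g | x in [set: S]].
have Jid : ideal J.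
  split; first by exists (a * a)%g; exists a.
  - by move=> _ _ [x _ <-] [y _ <-]; exists (x + y) => //; apply: csmulDl.
  - by move=> x _ [y _ <-]; exists (x * y)%g => //; rewrite mulgA.
have [two|ntwo] := pselect (at_least_two J).
  left=> y; have : J y by rewrite (Sis.2 J Jid two).
  by move=> [x _ <-]; exists x.
right; exists (a * a)%g => x; apply: contrapT => ne; apply: ntwo.
by exists (x * a)%g, (a * a)%g; split=> //; [exists x | exists a].
Qed.

Lemma ideal_simple_classification :
  [\/ parasemifield S,
      exists w : S, forall x y, (x * y)%g = w
    | exists2 w : S, w + w = w & exists e, semifield w e].
Proof.
(* An element e fixing a fixes all of S a = S. *)
have unitP a : (forall y, exists x, (x * a)%g = y) ->
    exists2 e, is_unit e & (e * a)%g = a.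
  move=> Ha; have [e Ee] := Ha a; exists e => //.
  by split=> // y _; have [x <-] := Ha y; rewrite csmulCA Ee.
have [noc|] := pselect (forall a, ~ exists w, forall x, (x * a)%g = w).
  have surj a : forall y, exists x, (x * a)%g = y.
    by case: (principal_ideal_alternative a) => // /noc.
  apply: Or31; have [[a [b [_ _ ab]]] _] := Sis.
  have [e ue _] := unitP a (surj a); exists e; split=> //.
    by move=> x; have [y Ey] := surj x e; exists y; rewrite csmulC.
  have [ae|] := pselect (a = e); last by exists a.
  by exists b => be; apply: ab; rewrite ae be.
move=> /existsNP[a0 /contrapT[w Hw]].
have wM x : (w * x)%g = w by rewrite csmulC -{1}(Hw w) mulgA Hw.
have ww : w + w = w by rewrite -{1 2}(wM w) -csmulDl csmulC wM.
(* The annihilator ideal: if it is all of [S], multiplication is constant; if it is {w}, every other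
   a satisfies S a = S. *)
pose J : set S := [set a | forall x, (x * a)%g = w].
have Jid : ideal J.
  split; first by exists a0.
  - by move=> x y Jx Jy z; rewrite csmulDr Jx Jy.
  - by move=> x y Jy z; rewrite mulgA Jy.
have [two|ntwo] := pselect (at_least_two J).
  apply: Or32; exists w => x y; have : J y by rewrite (Sis.2 J Jid two).
  exact.
have Jw a : J a -> a = w.
  move=> Ja; apply: contrapT => aw; apply: ntwo; exists a, w; split=> // x.
  by rewrite csmulC.
have surj a : a <> w -> forall y, exists x, (x * a)%g = y.
  move=> aw; case: (principal_ideal_alternative a) => // -[w' Hw'].
  by case: aw; apply: Jw => x; rewrite Hw' -(Hw' w) wM.
apply: Or33; exists w => //.
have [a aw] : exists a, a <> w.
  have [[x [y [_ _ xy]]] _] := Sis; have [xw|] := pselect (x = w); last by exists x.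
  by exists y => yw; apply: xy; rewrite xw yw.
have [e ue Ea] := unitP a (surj a aw); exists e; split=> //.
- by move=> x xw; have [y Ey] := surj x xw e; exists y; rewrite csmulC.
- by move=> ew; apply: aw; rewrite -Ea ew wM.
Qed.

End IdealSimple.

(** * The implication (C) => (C1) and the conclusion *)

Lemma unit_idempotent (S : csemiringType) (e : S) :
  is_unit e -> e + e = e -> additively_idempotent S.
Proof. by move=> [_ ue] ee x; rewrite -(ue x) // -csmulDl ee. Qed.

(* If [e + c] were invertible, so would be its square [e + (e + e) * c + c ^ 2],
   which is absorbed by [e + e = w]. *)
Lemma semifield_constant_addition (S : csemiringType) (w e : S) :
  semifield w e -> (forall x, w + x = w) -> e + e = w ->
  forall x y : S, x + y = w.
Proof.
move=> sf wD ee x y; have [_ ue] := semifield_unit sf.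
have wM := semifield_absorbing sf.
have [->|xw] := pselect (x = w); first exact: wD.
have [x' Ex] := semifield_inv sf xw; pose c := (x' * y)%g.
have -> : y = (x * c)%g by rewrite mulgA Ex ue.
rewrite -{1}(ue x) // csmulC -csmulDr.
have -> : e + c = w; last by rewrite csmulC wM.
apply: contrapT => ec; apply: (semifield_mul_neq sf ec ec).
rewrite csmulDl !csmulDr !ue // (csmulC c e) ue // -csaddA (csaddA c c).
have -> : c + c = w by rewrite -(ue c) // -csmulDl ee wM.
by rewrite wD csaddC wD.
Qed.

Lemma C_imp_C1 : statement_C -> statement_C1.
Proof.
move=> C S Sfg Sinf Sis.
case: (ideal_simple_classification Sis) => [pS|[w Hw]|[w ww [e sf]]].
- by left; apply: C.
- by case: Sinf; apply: null_multiplication_finite Hw.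
have ue := semifield_unit sf; have wM := semifield_absorbing sf.
have [we|we] := pselect (w + e = w).
  have wD x : w + x = w by rewrite -{1}(ue.2 x Logic.I) -{1}(wM x) -csmulDl we wM.
  have [ee|ee] := pselect (e + e = w).
    right; exists (unit_group sf); split.
    - exact: unit_group_infinite.
    - exact: unit_group_fg (semifield_constant_addition sf wD ee) Sfg.
    - exact: constant_semifield_isomorphic (semifield_constant_addition sf wD ee).
  left; apply: (unit_idempotent ue); apply: (semifield_idempotent sf) => //.
    by left.
  (* If p + q = w, then e + e = (p + b) + (q + c) is absorbed by [w]. *)
  move=> p q [_ [b Eb]] [_ [c Ec]] pq; apply: ee.
  by rewrite -{1}Eb -Ec csaddACA pq wD.
have w0 x : w + x = x.
  (* w + e is invertible and idempotent for multiplication, hence equal to [e]. *)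
  have {}we : w + e = e.
    have [u' Eu] := semifield_inv sf we.
    have uu : ((w + e) * (w + e))%g = w + e.
      by rewrite csmulDl wM ue.2 // csaddA ww.
    by have := congr1 (fun z => (z * u')%g) uu; rewrite -mulgA Eu csmulC ue.2.
  by rewrite -{1}(ue.2 x Logic.I) -{1}(wM x) -csmulDl we ue.2.
have [neg|nneg] := pselect (exists c, e + c == w).
  by case: Sinf; apply: semifield_field_finite sf w0 neg Sfg.
left; apply: (unit_idempotent ue).
(* If x + y = w with x invertible, dividing by x yields a negative of [e]. *)
have addn x y : x <> w -> x + y <> w.
  move=> xw E; have [x' Ex] := semifield_inv sf xw; apply: nneg.
  by exists (x' * y)%g; rewrite -Ex (csmulC x) -csmulDr E csmulC wM.
apply: (semifield_idempotent sf) => //.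
- by right.
- exact/addn/(semifield_neq sf).
- by move=> p q [pw _] _; apply: addn.
Qed.

Theorem proposition5p2 :
  (statement_A <-> statement_A1) /\
  (statement_A1 -> statement_B) /\
  (statement_B <-> statement_B1) /\
  (statement_B1 <-> statement_B2) /\
  (statement_B2 -> statement_C) /\
  (statement_C <-> statement_C1).
Proof.
split; first split; [|exact: A1_imp_A|].
  move=> A S Sfg Sd; apply: A => // a n n0.
  by have [b [Eb _]] := Sd a n n0; exists b.
split; first by move=> /A1_imp_A/A_imp_B2/B2_imp_B1/B1_imp_B.
split; first by split; [exact: B_imp_B1 | exact: B1_imp_B].
split; first by split; [exact: B1_imp_B2 | exact: B2_imp_B1].
split; first exact: B2_imp_C.
by split; [exact: C_imp_C1 | exact: C1_imp_C].
Qed.
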